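(* Let $d,p\in\mathbb{N}$, $A\in\mathbb{C}^{d\times d}$, $x_0\in\mathbb{C}^d$, $t_0,t\in\mathbb{C}$, and consider the initial value problem $\dot{x}(t)=Ax$, $x(t_0)=x_0$. Let a Runge-Kutta method of order $p$ be applied to this problem along the path $\gamma^*:[0,1]\to\mathbb{C}$, $$\gamma^*(x):=\frac{t_0-t}{2i\sin\left(\frac{\pi}{p+1}\right)}\left[e^{i\pi\left(\frac{1-2x}{p+1}\right)}-\cos\left(\frac{\pi}{p+1}\right)\right]+\frac{t_0+t}{2},$$ which connects $t_0=\gamma^*(0)$ to $t=\gamma^*(1)$, i.e. along the time grids $\Delta_n^{\gamma^*}$, $n\in\mathbb{N}$. Then the approximation at the terminal point is of order $p+1$, i.e. $$e^{(t-t_0)A}x_0-x_{\Delta_n^{\gamma^*}}(t)=\mathcal{O}\left(\frac{1}{n^{p+1}}\right)\quad\text{as } n\to\infty.$$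
   Context: For a path $\gamma:[0,1]\to\mathbb{C}$ and $n\in\mathbb{N}$, $\Delta_n^\gamma=[t_0,\dots,t_n]$ with $t_j=\gamma(j/n)$ is the associated time grid; its steps $t_{j+1}-t_j$ are complex numbers. An $s$-stage Runge-Kutta method (explicit or implicit) with coefficients $\mathfrak{A}\in\mathbb{C}^{s\times s}$, $\mathfrak{b},\mathfrak{c}\in\mathbb{C}^s$ applied to $\dot{x}=Ax$ has the one-step map $\Psi^{t+\tau,t}x=x+\tau\sum_{i=1}^s\mathfrak{b}_ik_i$, where $k_i=Ax+\tau\sum_{j=1}^{s}\mathfrak{A}_{i,j}Ak_j$, $\tau\in\mathbb{C}$; it is explicit if $\mathfrak{A}$ is strictly lower triangular. In the implicit case the one-step map is defined for $|\tau|$ sufficiently small, hence the grid function is defined for all sufficiently large $n$. The method has order $p$ in the usual sense: for sufficiently smooth right-hand sides the consistency error (exact flow minus one numerical step of size $\tau$) is $\mathcal{O}(|\tau|^{p+1})$ as $\tau\to0$. The grid function is $x_\Delta(t_0)=x_0$, $x_\Delta(t_{j+1})=\Psi^{t_{j+1},t_j}x_\Delta(t_j)$, defined recursively along the index $j$; $x_{\Delta_n^{\gamma^*}}(t)$ is its value at the last grid index $j=n$. *)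

(* Defs.v *)
From HB Require Import structures.
From mathcomp Require Import all_boot all_order all_algebra.
From mathcomp Require Import complex.
From mathcomp Require Import all_classical all_reals all_analysis.

Set Implicit Arguments.
Unset Strict Implicit.
Unset Printing Implicit Defensive.

Import Order.TTheory GRing.Theory Num.Theory numFieldNormedType.Exports.

Local Open Scope ring_scope.
Local Open Scope classical_set_scope.

(* [R[i]] seen as an abstract [numClosedFieldType], so that the normed module
   structure of numerical fields (hence topology, complex differentiability,
   Landau notations) is found on it and on matrices over it. *)
Definition Cplx (R : realType) : numClosedFieldType := R[i].

Section ComplexFunctions.
Context {R : realType}.
Local Notation C := (Cplx R).

Definition cexp (z : C) : C :=
  Complex (expR (complex.Re z) * cos (complex.Im z))
          (expR (complex.Re z) * sin (complex.Im z)).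

(* Square matrices form a normed module and a (nontrivial) ring only in
   dimension [d.+1], i.e. in positive dimension. *)
Definition expm (d : nat) (A : 'M[C]_d.+1) : 'M[C]_d.+1 :=
  limn (series (fun k : nat => (k`!%:R)^-1 *: A ^+ k)).

End ComplexFunctions.

Record rk_method (R : realType) (s : nat) := RKMethod {
  rkA : 'M[Cplx R]_s;
  rkb : 'cV[Cplx R]_s;
  rkc : 'cV[Cplx R]_s }.

Section RungeKutta.
Context {R : realType} {s m : nat}.
Local Notation C := (Cplx R).
Local Notation V := 'cV[C]_m.+1.

Definition rk_stages (M : rk_method R s) (f : C -> V -> V) (t : C) (x : V)
    (tau : C) (k : 'I_s -> V) : Prop :=
  forall i, k i = f (t + rkc M i 0 * tau)
                    (x + tau *: \sum_j rkA M i j *: k j).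

Definition rk_update (M : rk_method R s) (x : V) (tau : C)
    (k : 'I_s -> V) : V :=
  x + tau *: \sum_i rkb M i 0 *: k i.

(* Whether the one-step map is defined at [(t, x)] with step [tau]. *)
Definition rk_defined (M : rk_method R s) (f : C -> V -> V) (t : C) (x : V)
    (tau : C) : Prop :=
  exists! k, rk_stages M f t x tau k.

(* The one-step map $\Psi^{t+\tau,t}$; an arbitrary choice is made where
   [rk_defined] fails. *)
Definition rk_step (M : rk_method R s) (f : C -> V -> V) (t : C) (x : V)
    (tau : C) : V :=
  rk_update M x tau (get [set k | rk_stages M f t x tau k]).

Fixpoint rk_grid (M : rk_method R s) (f : C -> V -> V) (T : nat -> C)
    (x0 : V) (j : nat) : V :=
  if j is i.+1 then
    rk_step M f (T i) (rk_grid M f T x0 i) (T i.+1 - T i)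
  else x0.

End RungeKutta.

(* Consistency order (at least) [p].  Time being complex, the smooth
   right-hand sides are the holomorphic ones, [phi] is the exact solution
   through [(t, x)], and [k] is the local branch of solutions of the stage
   equations near [tau = 0]: by the implicit function theorem it exists and is
   unique near [0].  (For a nonlinear [f], an implicit method may have other,
   irrelevant, solutions of the stage equations away from [f t x].) *)
Definition rk_order (R : realType) (s : nat) (M : rk_method R s) (p : nat) :
    Prop :=
  forall (m : nat) (f : Cplx R -> 'cV[Cplx R]_m.+1 -> 'cV[Cplx R]_m.+1)
    (t : Cplx R) (x : 'cV[Cplx R]_m.+1)
    (phi : Cplx R -> 'cV[Cplx R]_m.+1)
    (k : Cplx R -> 'I_s -> 'cV[Cplx R]_m.+1),
  (\forall z \near (t, x),
     differentiable
       (fun y : Cplx R * 'cV[Cplx R]_m.+1 => f y.1 y.2) z) ->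
  phi t = x ->
  (\forall u \near t, is_derive u (1 : Cplx R) phi (f u (phi u))) ->
  (forall i, k ^~ i @ (0 : Cplx R) --> f t x) ->
  (\forall tau \near (0 : Cplx R), rk_stages M f t x tau (k tau)) ->
  (fun tau : Cplx R => phi (t + tau) - rk_update M x tau (k tau))
    =O_ (0 : Cplx R) (fun tau : Cplx R => tau ^+ p.+1).

Definition time_grid {R : realType} (gamma : R -> Cplx R) (n j : nat) :
    Cplx R :=
  gamma (j%:R / n%:R).

Definition gamma_star {R : realType} (p : nat) (t0 t : Cplx R) (x : R) :
    Cplx R :=
  let C_of (y : R) : Cplx R := y%:C%C in
  (t0 - t) / (2 * 'i * C_of (sin (pi / p.+1%:R)))
    * (cexp ('i * C_of (pi * ((1 - 2 * x) / p.+1%:R)))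
       - C_of (cos (pi / p.+1%:R)))
  + (t0 + t) / 2.

(* Main.v *)
Require Import Defs.
From mathcomp Require Import all_boot all_order all_algebra.
From mathcomp Require Import complex.
From mathcomp Require Import all_classical all_reals all_analysis.
From mathcomp Require Import ring lra.
Import Order.TTheory GRing.Theory Num.Theory numFieldNormedType.Exports.
Local Open Scope ring_scope.
Local Open Scope classical_set_scope.

(** For a linear problem the one-step map of a Runge-Kutta method is a
   power series in [tau A]: its [k]-th coefficient is [rk_weight M k], and order
   [p] forces this coefficient to be [1 / k!] for all [k <= p]
   ([rk_order_weight]).  Hence one step satisfies
     [Psi x = e^(tau A) x - kappa tau^(p+1) A^(p+1) x + O(tau^(p+2)) x]
   where [kappa = 1 / (p+1)! - rk_weight M (p+1)] ([rk_local_error]).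

   The exact flow commutes with [A], so transporting the numerical solution back to the
   initial time by the exact flow gives vectors [w j] with
     [w (j+1) = w j - kappa tau_j^(p+1) A^(p+1) w j + O(n^-(p+2))].
   A single increment is [O(n^-(p+1))], so every [w j] is within [O(n^-p)] of
   [w 0 = x0].  Replacing [w j] by [x0] in the leading term therefore costs
   [O(n^-2p)] in total, which is [O(n^-(p+1))] because [p >= 1], and what is left
   of the leading terms is [kappa (sum_j tau_j^(p+1)) A^(p+1) x0]
   ([recurrence_cancellation], [rk_grid_superconvergence]).

   Along the circular arc [gamma_star] the steps are
   [tau_j = c (zeta - 1) zeta^j] with [zeta = e^(-2 i pi / (n (p+1)))].  Their
   [(p+1)]-th powers are proportional to the [n]-th roots of unity, whose sum
   vanishes ([gamma_star_closed]): the leading error cancels.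

   Estimates are carried out with a real-valued submultiplicative matrix norm,
   and properties of the matrix exponential are obtained by comparing its partial
   sums with those of the real exponential series at the norm of the matrix
   ([expm_tail], [expmD]). *)

Set Implicit Arguments.
Unset Strict Implicit.
Unset Printing Implicit Defensive.

(** * Real-valued norms of complex numbers and matrices *)

Section RealNorms.
Context {R : realType}.
Local Notation C := (Cplx R).

(** The modulus as an element of [R]; the norm [`|z|] lies in [C]. *)
Definition cabs (z : C) : R := Normc.normc z.

Lemma normC_cabs (z : C) : `|z| = (cabs z)%:C%C.
Proof. by []. Qed.

Lemma cabs_ge0 z : 0 <= cabs z.
Proof. by rewrite -lecR -normC_cabs normr_ge0. Qed.

Lemma cabsM : {morph cabs : z w / z * w}.
Proof. exact: Normc.normcM. Qed.

Lemma cabs0 : cabs 0 = 0.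
Proof. exact: Normc.normc0. Qed.

Lemma cabs1 : cabs 1 = 1.
Proof. exact: Normc.normc1. Qed.

Lemma cabsX z n : cabs (z ^+ n) = cabs z ^+ n.
Proof. by elim: n => [|n IH]; rewrite ?cabs1 // !exprS cabsM IH. Qed.

Lemma cabsV z : cabs z^-1 = (cabs z)^-1.
Proof. exact: Normc.normcV. Qed.

Lemma cabsD z w : cabs (z + w) <= cabs z + cabs w.
Proof. exact: le_normcD. Qed.

Lemma cabsN z : cabs (- z) = cabs z.
Proof. exact: normcN. Qed.

Lemma cabs_nat n : cabs n%:R = n%:R.
Proof. by apply: (@complexI R); rewrite -normC_cabs normr_nat rmorph_nat. Qed.

Lemma cabs_sum (I : Type) (r : seq I) (P : pred I) (F : I -> C) :
  cabs (\sum_(i <- r | P i) F i) <= \sum_(i <- r | P i) cabs (F i).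
Proof.
apply: (big_ind2 (fun z x => cabs z <= x)) => //; first by rewrite cabs0.
by move=> z x w y zx wy; exact: le_trans (cabsD _ _) (lerD zx wy).
Qed.

Lemma cabs_eq0 z : cabs z = 0 -> z = 0.
Proof. exact: Normc.eq0_normc. Qed.

Lemma cabs_le_Re_Im (z : C) : cabs z <= `|complex.Re z| + `|complex.Im z|.
Proof.
rewrite /cabs; case: z => x y /=.
rewrite -[leRHS]ger0_norm ?addr_ge0// -sqrtr_sqr ler_wsqrtr//.
rewrite sqrrD !real_normK ?num_real// -addrA lerD2l lerDr.
by rewrite mulrn_wge0// mulr_ge0.
Qed.

Lemma le_Re_cabs (z : C) : `|complex.Re z| <= cabs z.
Proof. by rewrite -lecR -normC_cabs; exact: normc_ge_Re. Qed.

Lemma le_Im_cabs (z : C) : `|complex.Im z| <= cabs z.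
Proof.
rewrite /cabs; case: z => x y /=.
by rewrite -[leLHS]sqrtr_sqr ler_wsqrtr// lerDr sqr_ge0.
Qed.

(** The entrywise l1 norm rather than the sup norm [`|A|], because the latter is
   not submultiplicative and takes its values in [C]. *)
Definition l1norm m n (A : 'M[C]_(m, n)) : R := \sum_i \sum_j cabs (A i j).

Section Basic.
Context {m n : nat}.
Implicit Types A B : 'M[C]_(m, n).

Lemma l1norm_ge0 A : 0 <= l1norm A.
Proof. by apply: sumr_ge0 => i _; apply: sumr_ge0 => j _; exact: cabs_ge0. Qed.

Lemma l1norm0 : l1norm (0 : 'M[C]_(m, n)) = 0.
Proof. by rewrite /l1norm big1// => i _; rewrite big1// => j _; rewrite mxE cabs0. Qed.

Lemma cabs_le_l1norm A i j : cabs (A i j) <= l1norm A.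
Proof.
rewrite /l1norm (bigD1 i)//= (bigD1 j)//= -addrA lerDl addr_ge0//.
  by apply: sumr_ge0 => *; exact: cabs_ge0.
by apply: sumr_ge0 => ? _; apply: sumr_ge0 => *; exact: cabs_ge0.
Qed.

Lemma l1norm_eq0 A : l1norm A <= 0 -> A = 0.
Proof.
move=> A0; apply/matrixP => i j; rewrite mxE; apply: cabs_eq0.
by apply/eqP; rewrite eq_le cabs_ge0 andbT (le_trans (cabs_le_l1norm A i j)).
Qed.

Lemma l1normD A B : l1norm (A + B) <= l1norm A + l1norm B.
Proof.
rewrite /l1norm -big_split /=; apply: ler_sum => i _.
by rewrite -big_split /=; apply: ler_sum => j _; rewrite mxE cabsD.
Qed.

Lemma l1normZ (z : C) A : l1norm (z *: A) = cabs z * l1norm A.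
Proof.
rewrite /l1norm mulr_sumr; apply: eq_bigr => i _; rewrite mulr_sumr.
by apply: eq_bigr => j _; rewrite mxE cabsM.
Qed.

Lemma l1normN A : l1norm (- A) = l1norm A.
Proof. by rewrite -scaleN1r l1normZ cabsN cabs1 mul1r. Qed.

Lemma l1normB A B : l1norm (A - B) <= l1norm A + l1norm B.
Proof. by rewrite -(l1normN B) l1normD. Qed.

Lemma l1norm_distC A B : l1norm (A - B) = l1norm (B - A).
Proof. by rewrite -l1normN opprB. Qed.

Lemma l1norm_sum (I : Type) (r : seq I) (P : pred I) (F : I -> 'M[C]_(m, n)) :
  l1norm (\sum_(i <- r | P i) F i) <= \sum_(i <- r | P i) l1norm (F i).
Proof.
apply: (big_ind2 (fun z x => l1norm z <= x)) => //; first by rewrite l1norm0.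
by move=> z x w y zx wy; exact: le_trans (l1normD _ _) (lerD zx wy).
Qed.

Lemma l1norm_le_entries A (b : R) : (forall i j, cabs (A i j) <= b) ->
  l1norm A <= (m * n)%:R * b.
Proof.
move=> h; apply: (@le_trans _ _ (\sum_(i < m) \sum_(j < n) b)).
  by apply: ler_sum => i _; apply: ler_sum => j _.
by rewrite !sumr_const !card_ord -mulrnA mulr_natl mulnC.
Qed.

End Basic.

Lemma l1norm_mul m n q (A : 'M[C]_(m, n)) (B : 'M[C]_(n, q)) :
  l1norm (A *m B) <= l1norm A * l1norm B.
Proof.
rewrite {2}/l1norm mulr_suml; apply: ler_sum => i _.
apply: (@le_trans _ _ (\sum_j \sum_k cabs (A i k) * cabs (B k j))).
  apply: ler_sum => j _; rewrite mxE; apply: le_trans (cabs_sum _ _ _) _.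
  by apply: ler_sum => k _; rewrite cabsM.
rewrite exchange_big /= mulr_suml; apply: ler_sum => k _.
rewrite -mulr_sumr; apply: ler_wpM2l; first exact: cabs_ge0.
rewrite /l1norm (bigD1 k)//= lerDl.
by apply: sumr_ge0 => ? _; apply: sumr_ge0 => *; exact: cabs_ge0.
Qed.

Lemma l1norm_exp d (A : 'M[C]_d.+1) k :
  l1norm (A ^+ k) <= l1norm (1 : 'M[C]_d.+1) * l1norm A ^+ k.
Proof.
elim: k => [|k IH]; first by rewrite !expr0 mulr1.
rewrite exprSr exprSr mulrA; apply: le_trans (l1norm_mul _ _) _.
by apply: ler_wpM2r => //; exact: l1norm_ge0.
Qed.

Lemma norm_le_l1norm m n (A : 'M[C]_(m, n)) : `|A| <= (l1norm A)%:C%C.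
Proof.
rewrite [`|A|]/Num.Def.normr /=.
have [->|/mx_norm_neq0[i ->]] := eqVneq (mx_norm A) 0; first by rewrite lecR l1norm_ge0.
by rewrite normC_cabs lecR cabs_le_l1norm.
Qed.

Lemma le_entry_norm m n (A : 'M[C]_(m, n)) i j : `|A i j| <= `|A|.
Proof.
rewrite [`|A|]/Num.Def.normr /= mx_normE.
by rewrite -[leLHS]nngE num_le; exact: (le_bigmax _ (fun i => `|A i.1 i.2|%:nng) (i, j)).
Qed.

End RealNorms.

(** * Partial sums of the exponential series *)

Definition exp_sum (F : numFieldType) (B : algType F) (N : nat) (a : B) : B :=
  \sum_(k < N) (k`!%:R)^-1 *: a ^+ k.

(** The Cauchy product of two partial sums contains all monomials of
   [exp_sum N (a + b)], so that the defect consists of those of degree at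
   least [N].  Valid in any algebra, it is used both for matrices and for real
   numbers, where the same monomials give an upper bound. *)
Lemma exp_sumM (F : numFieldType) (B : algType F) (N : nat) (a b : B) :
  GRing.comm a b ->
  exp_sum N a * exp_sum N b - exp_sum N (a + b) =
  \sum_(i < N) \sum_(j < N | (N <= i + j)%N)
    ((i`!%:R)^-1 * (j`!%:R)^-1) *: (a ^+ i * b ^+ j).
Proof.
move=> ab; apply/eqP; rewrite subr_eq; apply/eqP.
pose T i j : B := ((i`!%:R)^-1 * (j`!%:R)^-1) *: (a ^+ i * b ^+ j).
have -> : exp_sum N a * exp_sum N b = \sum_(i < N) \sum_(j < N) T i j.
  rewrite /exp_sum big_distrl; apply: eq_bigr => i _ /=.
  by rewrite big_distrr; apply: eq_bigr => j _ /=; rewrite -scalerAl -scalerAr scalerA.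
have -> : exp_sum N (a + b) = \sum_(i < N) \sum_(j < N | (i + j < N)%N) T i j.
  (* The binomial formula lists the monomials by total degree [k = i + j]. *)
  have -> : exp_sum N (a + b) = \sum_(k < N) \sum_(i < N | (i <= k)%N) T i (k - i)%N.
    apply: eq_bigr => k _; rewrite addrC (exprDn_comm _ (commr_sym ab)) scaler_sumr.
    rewrite (big_ord_widen N (fun i => (k`!%:R)^-1 *:
       (b ^+ (k - i) * a ^+ i *+ 'C(k, i)))) ?ltn_ord//.
    apply: eq_bigr => i; rewrite ltnS => ik.
    rewrite /T -[_ *+ 'C(k, i)]scaler_nat scalerA; congr (_ *: _); last first.
      by apply: commrX; apply: commr_sym; apply: commrX; exact: commr_sym.
    have /(congr1 (fun n => n%:R : F)) := bin_fact ik.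
    rewrite !natrM => <-.
    have h n : (n`!)%:R != 0 :> F by rewrite pnatr_eq0 -lt0n fact_gt0.
    have : 'C(k, i)%:R != 0 :> F by rewrite pnatr_eq0 -lt0n bin_gt0.
    move: (h i) (h (k - i)%N) => h1 h2 h3.
    by field; rewrite h1 h2 h3.
  rewrite (exchange_big_dep xpredT)//=; apply: eq_bigr => i _.
  have iN := ltn_ord i.
  have := big_mkord (fun j => (i + j < N)%N) (fun j => T i j) (n := N).
  move=> <-; have := big_mkord (fun k => (i <= k)%N) (fun k => T i (k - i)%N) (n := N).
  move=> <-.
  rewrite [LHS](big_cat_nat (n := i)) ?(ltnW iN)//= big_nat_cond big1 ?add0r; last first.
    by move=> k /andP[/andP[_ ki]]; rewrite leqNgt ki.
  rewrite [RHS](big_cat_nat (n := (N - i)%N)) ?leq_subr//= [X in _ + X]big_nat_cond.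
  rewrite [X in _ + X]big1 ?addr0; last first.
    move=> k /andP[/andP[ki _]]; rewrite leq_subLR in ki.
    by rewrite ltnNge ki.
  rewrite -{1}[val i]add0n big_addn big_nat_cond [RHS]big_nat_cond.
  apply: eq_big => k; last by move=> _; rewrite addnK.
  by rewrite leq_addl andbT; case: ltnP => //= h; rewrite -ltn_subRL h.
rewrite -big_split /=; apply: eq_bigr => i _.
rewrite [LHS](bigID (fun j : 'I_N => (N <= i + j)%N))/=; congr (_ + _).
by apply: eq_bigl => j; rewrite ltnNge.
Qed.

Section Exponential.
Context {R : realType}.
Local Notation C := (Cplx R).

Lemma exp_sum_real N (x : R) : exp_sum N (x : R^o) = series (exp_coeff x) N.
Proof.
rewrite /exp_sum /series /= big_mkord; apply: eq_bigr => k _.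
by rewrite /exp_coeff /= mulrC.
Qed.

Definition exp_tail (x : R) (N : nat) : R := expR x - exp_sum N (x : R^o).

Lemma exp_tail_cvg (x : R) : exp_tail x @ \oo --> (0 : R).
Proof.
have h : (fun N => exp_sum N (x : R^o)) @ \oo --> expR x.
  have := @is_cvg_series_exp_coeff R x.
  by rewrite (_ : (fun N => _) = series (exp_coeff x))//; apply/funext => N;
    rewrite exp_sum_real.
rewrite -(subrr (expR x)).
by apply: cvgB => //; exact: cvg_cst.
Qed.

Lemma exp_sum_le_mono (x : R) N M : 0 <= x -> (N <= M)%N ->
  exp_sum N (x : R^o) <= exp_sum M (x : R^o).
Proof.
move=> x0 NM; rewrite !exp_sum_real /series /= (big_cat_nat (leq0n N) NM)//= lerDl.
by apply: sumr_ge0 => k _; exact: exp_coeff_ge0.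
Qed.

Lemma exp_tail_ge0 (x : R) N : 0 <= x -> 0 <= exp_tail x N.
Proof.
move=> x0; rewrite /exp_tail subr_ge0 exp_sum_real.
apply: nondecreasing_cvgn_le; last exact: is_cvg_series_exp_coeff.
by move=> n m nm; rewrite -!exp_sum_real exp_sum_le_mono.
Qed.

Lemma exp_sum_le_expR (x : R) N : 0 <= x -> exp_sum N (x : R^o) <= expR x.
Proof. by move=> x0; rewrite -subr_ge0; exact: exp_tail_ge0. Qed.

Lemma exp_tail_le (x : R) N : 0 <= x -> exp_tail x N <= x ^+ N * expR x.
Proof.
move=> x0; rewrite /exp_tail lerBlDr.
apply: limr_le; first exact: is_cvg_series_exp_coeff.
exists N => // M /= NM.
rewrite exp_sum_real [leLHS]/series /= (big_cat_nat (leq0n N) NM)//= addrC lerD2r.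
rewrite -{1}[N]add0n big_addn big_mkord.
apply: (@le_trans _ _ (x ^+ N * exp_sum (M - N) (x : R^o))); last first.
  by rewrite ler_wpM2l ?exprn_ge0// exp_sum_le_expR.
rewrite /exp_sum mulr_sumr; apply: ler_sum => k _.
rewrite /exp_coeff /= exprD [x ^+ k * _]mulrC -mulrA ler_wpM2l ?exprn_ge0//.
rewrite [leRHS]mulrC ler_wpM2l ?exprn_ge0//.
by rewrite lef_pV2 ?posrE ?ltr0n ?fact_gt0// ler_nat leq_fact// leq_addr.
Qed.

(** Equalities between matrix exponentials are obtained from this lemma: the norm
   of the difference is bounded by exponential tails. *)
Lemma le0_of_cvg (b : R^nat) (x K : R) : b @ \oo --> (0 : R) ->
  (forall N, x <= K * b N) -> x <= 0.
Proof.
move=> b0 xb; have h : (fun N => K * b N) @ \oo --> K * 0 by apply: cvgMr.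
rewrite mulr0 in h; rewrite -(cvg_lim _ h)//.
apply: limr_ge; first exact: (cvgP 0).
by apply: nearW.
Qed.

(** The increments of [u] are dominated by those of a convergent sequence [b]; then
   [b] is nondecreasing and so is [u + b], which is bounded, hence [u] converges
   and the domination passes to the limit. *)
Lemma real_seq_limit (u b : R^nat) (B : R) : b @ \oo --> B ->
  (forall N M, (N <= M)%N -> `|u M - u N| <= b M - b N) ->
  exists l, forall N, `|l - u N| <= B - b N.
Proof.
move=> bB ub.
have bn : nondecreasing_seq b.
  by move=> n m nm; rewrite -subr_ge0; exact: le_trans (ub _ _ nm).
have bleB N : b N <= B.
  by rewrite -(cvg_lim _ bB)//; apply: nondecreasing_cvgn_le => //; exact: (cvgP B).
have [l ul] : exists l : R, (u + b) @ \oo --> l.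
  apply: (cvg_ex _).1; apply: nondecreasing_is_cvgn.
    move=> n m nm; have := ub _ _ nm; rewrite ler_norml => /andP[h _].
    by rewrite !fctE; lra.
  exists (u 0%N - b 0%N + B + B) => _ [n _ <-]; rewrite !fctE.
  have := ub _ _ (leq0n n); rewrite ler_norml => /andP[_ h].
  by have := bleB n; lra.
have uc : u @ \oo --> l - B.
  rewrite (_ : u = (u + b) - b); first exact: cvgB.
  by apply/funext => n; rewrite !fctE addrK.
exists (l - B) => N.
have h1 : (fun M => `|u M - u N|) @ \oo --> `|(l - B) - u N|.
  by apply: cvg_norm; apply: cvgB => //; exact: cvg_cst.
rewrite -(cvg_lim _ h1)//; apply: limr_le; first exact: (cvgP _ h1).
exists N => // M /= NM; apply: le_trans (ub _ _ NM) _.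
by rewrite lerD2r.
Qed.

Lemma complex_seq_limit (u : nat -> C) (b : R^nat) (B : R) : b @ \oo --> B ->
  (forall N M, (N <= M)%N -> cabs (u M - u N) <= b M - b N) ->
  exists l, forall N, cabs (l - u N) <= 2 * (B - b N).
Proof.
move=> bB ub.
have ReB (z w : C) : complex.Re (z - w) = complex.Re z - complex.Re w.
  by case: z; case: w.
have ImB (z w : C) : complex.Im (z - w) = complex.Im z - complex.Im w.
  by case: z; case: w.
have [|x xP] := @real_seq_limit (fun n => complex.Re (u n)) b B bB.
  by move=> N M NM; rewrite -ReB; exact: le_trans (le_Re_cabs _) (ub _ _ NM).
have [|y yP] := @real_seq_limit (fun n => complex.Im (u n)) b B bB.
  by move=> N M NM; rewrite -ImB; exact: le_trans (le_Im_cabs _) (ub _ _ NM).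
exists (Complex x y : C) => N; apply: le_trans (cabs_le_Re_Im _) _.
by rewrite ReB ImB /= mulr_natl mulr2n lerD.
Qed.

End Exponential.

(** * The matrix exponential *)

Section MatrixExponential.
Context {R : realType} {d : nat}.
Local Notation C := (Cplx R).
Local Notation M := 'M[C]_d.+1.
Implicit Types A B : M.

Lemma expm_series A N : series (fun k : nat => (k`!%:R)^-1 *: A ^+ k) N = exp_sum N A.
Proof. by rewrite /series /= big_mkord. Qed.

Lemma cabs_inv_fact k : cabs ((k`!%:R)^-1 : C) = (k`!%:R)^-1.
Proof. by rewrite cabsV cabs_nat. Qed.

Lemma exp_sum_cauchy A N K : (N <= K)%N ->
  l1norm (exp_sum K A - exp_sum N A) <=
  l1norm (1 : M) * (exp_sum K (l1norm A : R^o) - exp_sum N (l1norm A : R^o)).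
Proof.
move=> NK; rewrite -!expm_series !exp_sum_real /series /= !(big_cat_nat (leq0n N) NK)/=.
rewrite !(addrC (\sum_(0 <= i < N) _)) !addrK mulr_sumr.
apply: le_trans (l1norm_sum _ _ _) _; apply: ler_sum => k _.
rewrite l1normZ cabs_inv_fact /exp_coeff /= mulrA [leRHS]mulrC.
by rewrite ler_wpM2l ?invr_ge0// l1norm_exp.
Qed.

(** The real and imaginary parts of every entry of the partial sums are dominated
   by the real exponential series.  This gives convergence and the bound at the
   same time; all that is needed about [expm] follows from this bound. *)
Lemma expm_tail : exists2 K : R, 0 <= K &
  forall A N, l1norm (expm A - exp_sum N A) <= K * exp_tail (l1norm A) N.
Proof.
exists ((d.+1 * d.+1)%:R * (2 * l1norm (1 : M))).
  by rewrite !mulr_ge0// l1norm_ge0.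
move=> A.
pose b N := l1norm (1 : M) * exp_sum N (l1norm A : R^o).
have bB : b @ \oo --> l1norm (1 : M) * expR (l1norm A).
  apply: cvgMr; rewrite (_ : (fun _ => _) = series (exp_coeff (l1norm A))); last first.
    by apply/funext => N; rewrite exp_sum_real.
  exact: is_cvg_series_exp_coeff.
have /choice[E EP] : forall ij : 'I_d.+1 * 'I_d.+1, exists l : C, forall N,
    cabs (l - exp_sum N A ij.1 ij.2) <= 2 * (l1norm (1 : M) * expR (l1norm A) - b N).
  move=> [i j] /=; apply: (complex_seq_limit bB) => N K NK.
  rewrite /b -mulrBr; apply: le_trans (exp_sum_cauchy _ NK).
  by have := cabs_le_l1norm (exp_sum K A - exp_sum N A) i j; rewrite !mxE.
pose L : M := \matrix_(i, j) E (i, j).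
have LP N : l1norm (L - exp_sum N A) <=
    (d.+1 * d.+1)%:R * (2 * l1norm (1 : M)) * exp_tail (l1norm A) N.
  rewrite -!mulrA; apply: l1norm_le_entries => i j.
  by have := EP (i, j) N; rewrite /b -mulrBr !mxE.
suff -> : expm A = L by [].
rewrite /expm; apply: cvg_lim; first exact: norm_hausdorff.
apply/cvgrPdist_le => e e0.
have er : (complex.Re e)%:C%C = e by apply: RRe_real; exact: gtr0_real.
have e'0 : 0 < complex.Re e by rewrite -ltcR er.
set K := (_ * _) in LP.
have : (fun N => K * exp_tail (l1norm A) N) @ \oo --> K * 0.
  by apply: cvgMr; exact: exp_tail_cvg.
rewrite mulr0 => /cvgrPdist_le /(_ _ e'0); apply: filterS => N /=.
rewrite sub0r normrN => h.
apply: le_trans (norm_le_l1norm _) _.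
rewrite -er lecR expm_series.
by apply: le_trans (LP N) _; exact: le_trans (ler_norm _) h.
Qed.

End MatrixExponential.

Section MatrixExponentialTheory.
Context {R : realType} {d : nat}.
Local Notation C := (Cplx R).
Local Notation M := 'M[C]_d.+1.
Implicit Types A B : M.

Lemma l1norm_mulr A B : l1norm (A * B) <= l1norm A * l1norm B.
Proof. exact: l1norm_mul. Qed.

Lemma expm_taylor : exists2 K : R, 0 <= K &
  forall A N, l1norm (expm A - exp_sum N A) <= K * (l1norm A ^+ N * expR (l1norm A)).
Proof.
have [K K0 KP] := @expm_tail R d; exists K => // A N.
by apply: le_trans (KP A N) _; rewrite ler_wpM2l// exp_tail_le ?l1norm_ge0.
Qed.

Lemma l1norm_expm : exists2 K : R, 0 <= K &
  forall A, l1norm (expm A) <= K * expR (l1norm A).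
Proof.
have [K K0 KP] := expm_taylor; exists K => // A.
by have := KP A 0%N; rewrite /exp_sum big_ord0 subr0 expr0 mul1r.
Qed.

Lemma expm0 : expm (0 : M) = 1.
Proof.
have [K _ /(_ 0 1%N)] := expm_taylor.
rewrite l1norm0 expr1 mul0r mulr0 /exp_sum big_ord1 expr0 fact0 invr1 scale1r.
by move=> /l1norm_eq0/subr0_eq.
Qed.

Lemma expm_comm A B : GRing.comm A B -> GRing.comm A (expm B).
Proof.
move=> AB; apply: subr0_eq; apply: l1norm_eq0.
have [K K0 KP] := @expm_tail R d.
apply: (@le0_of_cvg _ (exp_tail (l1norm B)) _ (2 * (l1norm A * K))); first exact: exp_tail_cvg.
move=> N; set S := exp_sum N B.
have AS : A * S = S * A.
  by apply: commr_sum => k _; rewrite /GRing.comm -scalerAr -scalerAl (commrX _ AB).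
have -> : A * expm B - expm B * A = A * (expm B - S) - (expm B - S) * A.
  by rewrite mulrBr mulrBl AS opprB addrA subrK.
apply: le_trans (l1normB _ _) _.
rewrite -mulrA mulr_natl mulr2n lerD//.
  apply: le_trans (l1norm_mulr _ _) _.
  by rewrite -mulrA ler_wpM2l ?l1norm_ge0// KP.
apply: le_trans (l1norm_mulr _ _) _.
by rewrite mulrC -mulrA ler_wpM2l ?l1norm_ge0// KP.
Qed.

Lemma l1norm_exp_sum A N : l1norm (exp_sum N A) <= l1norm (1 : M) * expR (l1norm A).
Proof.
have := @exp_sum_cauchy R d A 0 N (leq0n N).
rewrite /exp_sum !big_ord0 !subr0 => h; apply: le_trans h _.
by rewrite ler_wpM2l ?l1norm_ge0// exp_sum_le_expR// l1norm_ge0.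
Qed.

(** The defect of multiplicativity of the partial sums is a sum of monomials,
   so it is dominated by the defect of the real partial sums at the norms. *)
Lemma exp_sumM_defect A B N : GRing.comm A B ->
  l1norm (exp_sum N A * exp_sum N B - exp_sum N (A + B)) <=
  l1norm (1 : M) ^+ 2 * exp_tail (l1norm A + l1norm B) N.
Proof.
move=> AB; have a0 := l1norm_ge0 A; have b0 := l1norm_ge0 B.
apply: (@le_trans _ _ (l1norm (1 : M) ^+ 2 *
  (exp_sum N (l1norm A : R^o) * exp_sum N (l1norm B : R^o)
   - exp_sum N (l1norm A + l1norm B : R^o)))); last first.
  rewrite ler_wpM2l ?exprn_ge0 ?l1norm_ge0// /exp_tail lerD2r expRD ler_pM//.
  - by have := exp_sum_le_mono a0 (leq0n N); rewrite {1}/exp_sum big_ord0.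
  - by have := exp_sum_le_mono b0 (leq0n N); rewrite {1}/exp_sum big_ord0.
  - exact: exp_sum_le_expR.
  - exact: exp_sum_le_expR.
rewrite (exp_sumM _ AB).
have -> := @exp_sumM R R^o N (l1norm A) (l1norm B) (mulrC _ _).
rewrite mulr_sumr; apply: le_trans (l1norm_sum _ _ _) _; apply: ler_sum => i _.
rewrite mulr_sumr; apply: le_trans (l1norm_sum _ _ _) _; apply: ler_sum => j _.
rewrite l1normZ cabsM !cabs_inv_fact [leRHS]mulrCA.
rewrite ler_wpM2l ?mulr_ge0 ?invr_ge0//.
apply: le_trans (l1norm_mulr _ _) _; rewrite expr2 mulrACA.
by rewrite ler_pM ?l1norm_ge0 ?l1norm_exp.
Qed.

Lemma expmD A B : GRing.comm A B -> expm (A + B) = expm A * expm B.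
Proof.
move=> AB; apply/esym/subr0_eq; apply: l1norm_eq0.
have [K K0 KP] := @expm_tail R d.
have [L L0 LP] := l1norm_expm.
set a := l1norm A; set b := l1norm B; set c := l1norm (A + B).
have a0 : 0 <= a := l1norm_ge0 A; have b0 : 0 <= b := l1norm_ge0 B.
have c0 : 0 <= c := l1norm_ge0 _.
pose ts N := exp_tail a N + exp_tail b N + exp_tail (a + b) N + exp_tail c N.
pose m1 := l1norm (1 : M).
have m0 : 0 <= m1 := l1norm_ge0 _.
pose Q := K * (L * expR b) + m1 * expR a * K + m1 ^+ 2 + K.
have ts0 : ts @ \oo --> (0 : R).
  have : ts @ \oo --> (0 + 0 + 0 + 0 : R).
    by apply: cvgD; [apply: cvgD; [apply: cvgD|]|]; exact: exp_tail_cvg.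
  by rewrite !addr0.
apply: (@le0_of_cvg _ ts _ Q ts0) => N.
have ta := exp_tail_ge0 N a0; have tb := exp_tail_ge0 N b0.
have tab := exp_tail_ge0 N (addr_ge0 a0 b0); have tc := exp_tail_ge0 N c0.
set EA := expm A; set EB := expm B; set E := expm (A + B).
pose SA := exp_sum N A; pose SB := exp_sum N B; pose S := exp_sum N (A + B).
have -> : EA * EB - E = (EA - SA) * EB + SA * (EB - SB) + (SA * SB - S) - (E - S).
  by rewrite mulrBl mulrBr opprB !addrA !subrK.
have h1 : l1norm ((EA - SA) * EB) <= K * (L * expR b) * exp_tail a N.
  apply: le_trans (l1norm_mulr _ _) _; rewrite mulrAC.
  by rewrite ler_pM ?l1norm_ge0 ?KP ?LP.
have h2 : l1norm (SA * (EB - SB)) <= m1 * expR a * K * exp_tail b N.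
  apply: le_trans (l1norm_mulr _ _) _; rewrite -mulrA.
  by rewrite ler_pM ?l1norm_ge0 ?KP ?l1norm_exp_sum.
have h3 : l1norm (SA * SB - S) <= m1 ^+ 2 * exp_tail (a + b) N := exp_sumM_defect N AB.
have h4 : l1norm (E - S) <= K * exp_tail c N := KP _ _.
have k1 : 0 <= K * (L * expR b) by rewrite !mulr_ge0 ?expR_ge0.
have k2 : 0 <= m1 * expR a * K by rewrite !mulr_ge0 ?expR_ge0.
have k3 : 0 <= m1 ^+ 2 by rewrite exprn_ge0.
apply: le_trans (l1normB _ _) _; apply: (le_trans (lerD (l1normD _ _) (lexx _))).
apply: (le_trans (lerD (lerD (l1normD _ _) (lexx _)) (lexx _))).
apply: (le_trans (lerD (lerD (lerD h1 h2) h3) h4)).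
have hl k x : 0 <= k -> x <= ts N -> k * x <= k * ts N.
  by move=> k0; exact: ler_wpM2l.
rewrite /Q !mulrDl.
by apply: lerD; [apply: lerD; [apply: lerD|]|]; apply: hl => //; rewrite /ts; lra.
Qed.

End MatrixExponentialTheory.

(** * The stability series of a method and its order conditions *)

Lemma is_derive_scale_cst (K : numFieldType) (V : normedModType K)
    (g : K -> K) (e : V) (u dg : K) :
  is_derive u 1 g dg -> is_derive u 1 (fun w => g w *: e) (dg *: e).
Proof.
move=> [dg1 dg2].
have gP : h^-1 *: ((g \o shift u) (h *: (1 : K)) - g u) @[h --> 0^'] --> dg.
  by rewrite -dg2; exact: dg1.
have hP : h^-1 *: (((fun w => g w *: e) \o shift u) (h *: (1 : K)) - g u *: e)
    @[h --> 0^'] --> dg *: e.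
  rewrite (_ : (fun h => _) = fun h =>
      (h^-1 *: ((g \o shift u) (h *: (1 : K)) - g u)) *: e).
    exact: cvgZl.
  by apply/funext => h /=; rewrite -scalerBl scalerA.
by split; [exact: (cvgP _ hP)|exact: (cvg_lim (@norm_hausdorff _ _) hP)].
Qed.

Lemma expr_continuous (K : numFieldType) n : continuous (fun w : K => w ^+ n).
Proof.
move=> x; elim: n => [|n /(continuousM cvg_id) ih]; first exact: cst_continuous.
by rewrite /continuous_at exprS; under eq_fun do rewrite exprS; exact: ih.
Qed.

Section OrderConditions.
Context {R : realType} {s : nat}.
Local Notation C := (Cplx R).
Variable M : rk_method R s.

(** The [q]-th Taylor coefficient at [z = 0] of the stage values of
   [y' = z y], [y = 1]. *)
Definition stage_weight (q : nat) : 'cV[C]_s := rkA M ^+ q *m const_mx 1.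

(** The [k]-th Taylor coefficient at [z = 0] of the stability function
   [1 + z b^T (1 - z a)^-1 1], where [a = rkA M] and [b = rkb M]. *)
Definition rk_weight (k : nat) : C :=
  if k is q.+1 then \sum_i rkb M i 0 * stage_weight q i 0 else 1.

Lemma stage_weight0 i : stage_weight 0 i 0 = 1.
Proof. by rewrite /stage_weight expr0 mul1mx mxE. Qed.

Lemma stage_weightS q i :
  stage_weight q.+1 i 0 = \sum_j rkA M i j * stage_weight q j 0.
Proof. by rewrite /stage_weight exprS -mulmxA mxE. Qed.

Section Chain.
Variable p : nat.

(** The nilpotent system [y_0' = 0], [y_(r+1)' = y_r]. *)
Definition chain_mx : 'M[C]_p.+1 := \matrix_(i, j) ((i : nat) == j.+1)%:R.

Lemma chain_mxE (y : 'cV[C]_p.+1) i :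
  (chain_mx *m y) i 0 = if (i : nat) is q.+1 then y (inord q) 0 else 0.
Proof.
rewrite mxE; case: i => -[|q] /= qp.
  by rewrite big1// => j _; rewrite mxE /= mul0r.
rewrite (bigD1 (inord q))//= mxE /= inordK ?(ltnW qp)// eqxx mul1r big1 ?addr0//.
move=> j jq; rewrite mxE /= eqSS; case: eqP => [qj|]; last by rewrite mul0r.
by case/eqP: jq; apply/val_inj; rewrite /= inordK ?(ltnW qp).
Qed.

(** The column with entries [g r], written as a linear combination of constant
   vectors so that limits and derivatives can be taken term by term. *)
Definition colf (g : nat -> C) : 'cV[C]_p.+1 :=
  \sum_(r < p.+1) g r *: delta_mx r 0.

Lemma colfE g i : colf g i 0 = g i.
Proof.
rewrite /colf summxE (bigD1 i)//= !mxE !eqxx mulr1 big1 ?addr0// => j ji.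
by rewrite !mxE eq_sym (negPf ji) mulr0.
Qed.

(** Solution of the chain issued from the first basis vector at time [0]. *)
Definition chain_flow (u : C) := colf (fun r => (r`!%:R)^-1 * u ^+ r).

Definition chain_stage (tau : C) (i : 'I_s) :=
  colf (fun r => if r is q.+1 then stage_weight q i 0 * tau ^+ q else 0).

Lemma chain_colf g :
  chain_mx *m colf g = colf (fun r => if r is q.+1 then g q else 0).
Proof.
apply/colP => i; rewrite chain_mxE colfE.
by case: i => -[|q] //= qp; rewrite colfE inordK// ltnW.
Qed.

Lemma chain_stagesP (tau : C) :
  rk_stages M (fun _ x => chain_mx *m x) 0 (chain_flow 0) tau (chain_stage tau).
Proof.
move=> i.
have -> : chain_flow 0 + tau *: \sum_j rkA M i j *: chain_stage tau j =
    colf (fun r => stage_weight r i 0 * tau ^+ r).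
  apply/colP => r; rewrite [LHS]mxE [chain_flow 0 r 0]colfE [X in _ + X]mxE summxE ?colfE.
  under eq_bigr do rewrite mxE [chain_stage _ _ _ _]colfE.
  case: r => -[|q] /= qp.
    rewrite expr0 fact0 invr1 !mulr1 stage_weight0 big1 ?mulr0 ?addr0//.
    by move=> j _; rewrite mulr0.
  rewrite expr0n /= mulr0 add0r stage_weightS mulr_sumr mulr_suml.
  by apply: eq_bigr => j _; rewrite exprS; ring.
by rewrite chain_colf.
Qed.

Lemma chain_updateE (tau : C) r :
  rk_update M (chain_flow 0) tau (chain_stage tau) r 0 = rk_weight r * tau ^+ r.
Proof.
rewrite /rk_update [LHS]mxE [chain_flow 0 r 0]colfE [X in _ + X]mxE summxE.
under eq_bigr do rewrite mxE [chain_stage _ _ _ _]colfE.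
case: r => -[|q] /= qp.
  rewrite expr0 fact0 invr1 !mulr1 big1 ?mulr0 ?addr0//.
  by move=> j _; rewrite mulr0.
rewrite expr0n /= mulr0 add0r mulr_sumr mulr_suml.
by apply: eq_bigr => j _; rewrite exprS; ring.
Qed.

Lemma chain_flow_derive (u : C) :
  is_derive u (1 : C) chain_flow (chain_mx *m chain_flow u).
Proof.
rewrite /chain_flow chain_colf.
have := @is_derive_sum C C 'cV[C]_p.+1 p.+1
  (fun r w => ((r`!%:R)^-1 * w ^+ r) *: delta_mx r 0) u 1
  (fun r => ((if (r : nat) is q.+1 then (q`!%:R)^-1 * u ^+ q else 0) *: delta_mx r 0)).
rewrite (_ : \sum_(r < p.+1) (fun w : C => _) = chain_flow); last first.
  by apply/funext => w; rewrite fct_sumE.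
apply => r; apply: is_derive_scale_cst.
have -> : (fun w : C => (r`!%:R)^-1 * w ^+ r) = (r`!%:R)^-1 \*: (id ^+ r : C -> C).
  by apply/funext => w; rewrite fctE.
apply: is_derive_eq.
case: (r : nat) => [|q]; first by rewrite !mul0r scale0r scaler0.
have q1 : q.+1%:R != 0 :> C by rewrite pnatr_eq0.
have qf : q`!%:R != 0 :> C by rewrite pnatr_eq0 -lt0n fact_gt0.
rewrite /= /GRing.scale /= mulr1 factS natrM.
by field; rewrite nat1r q1 qf.
Qed.

Lemma chain_differentiable (y : C * 'cV[C]_p.+1) :
  differentiable (fun y : C * 'cV[C]_p.+1 => chain_mx *m y.2) y.
Proof.
have -> : (fun y : C * 'cV[C]_p.+1 => chain_mx *m y.2) =
    \sum_(j < p.+1) (fun y : C * 'cV[C]_p.+1 => y.2 j 0 *: col j chain_mx).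
  apply/funext => z; rewrite fct_sumE; apply/colP => i.
  rewrite summxE [LHS]mxE; apply: eq_bigr => j _.
  by rewrite [RHS]mxE [X in _ = _ * X]mxE mulrC.
apply: differentiable_sum => j; apply: differentiableZl.
have snd_diff : differentiable (snd : C * 'cV[C]_p.+1 -> 'cV[C]_p.+1) y.
  by apply: linear_differentiable => z; exact: cvg_snd.
exact: (differentiable_comp snd_diff (differentiable_coord _ _ _)).
Qed.

End Chain.

Lemma continuous_colf p (g : nat -> C -> C) (x : C) :
  (forall r, {for x, continuous (g r)}) ->
  (fun u => colf p (g ^~ u)) @ x --> colf p (g ^~ x).
Proof.
move=> gx; rewrite /colf.
have ac : continuous (fun z : 'cV[C]_p.+1 * 'cV[C]_p.+1 => z.1 + z.2).
  exact: add_continuous.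
have := @cvg_big 'cV[C]_p.+1 _ +%R 0 xpredT ac C (nbhs x)
  (index_enum 'I_p.+1) (fun r u => g r u *: delta_mx r 0) (fun r => g r x *: delta_mx r 0) _.
apply => r _; apply: cvgZl; exact: gx.
Qed.

(** The order conditions for linear problems.  On the nilpotent chain the flow and
   the numerical solution are both polynomials in the step [tau]: their [r]-th
   components are [tau^r / r!] and [rk_weight r * tau^r].  These differ by
   [O(tau^(p+1))] and [r <= p], so the coefficients agree. *)
Lemma rk_order_weight p : rk_order M p ->
  forall r, (r <= p)%N -> rk_weight r = (r`!%:R)^-1.
Proof.
move=> hM r rp.
have := hM p (fun _ x => chain_mx p *m x) 0 (chain_flow p 0) (chain_flow p)
  (chain_stage p).
have h0 : \forall z \near ((0 : C), chain_flow p 0),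
    differentiable (fun y : C * 'cV[C]_p.+1 => chain_mx p *m y.2) z.
  by near=> z; exact: chain_differentiable.
move=> /(_ h0 erefl).
have h1 : \forall u \near (0 : C),
    is_derive u (1 : C) (chain_flow p) (chain_mx p *m chain_flow p u).
  by near=> u; exact: chain_flow_derive.
move=> /(_ h1).
have h2 (i : 'I_s) : (chain_stage p)^~ i @ (0 : C) --> chain_mx p *m chain_flow p 0.
  rewrite /chain_flow chain_colf /chain_stage.
  have := @continuous_colf p
    (fun r u => if r is q.+1 then stage_weight q i 0 * u ^+ q else 0) 0.
  rewrite (_ : colf p _ = colf p (fun r : nat =>
      if r is q.+1 then (q`!%:R)^-1 * 0 ^+ q else 0)); last first.
    apply/colP => j; rewrite !colfE; case: (j : nat) => [//|[|q]].
      by rewrite !expr0 fact0 invr1 stage_weight0.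
    by rewrite expr0n /= !mulr0.
  apply => -[|q]; rewrite /prop_for /continuous_at; first exact: (@cst_continuous C C 0 0).
  have := @cvgMr C C (nbhs (0 : C)) _ (fun u => u ^+ q) (stage_weight q i 0) (0 ^+ q).
  by apply; exact: (@expr_continuous C q 0).
move=> /(_ h2).
have h3 : \forall tau \near (0 : C),
    rk_stages M (fun _ x => chain_mx p *m x) 0 (chain_flow p 0) tau (chain_stage p tau).
  by near=> tau; exact: chain_stagesP.
move=> /(_ h3) /eqO_exP[K K0 KP].
apply/eqP; rewrite eq_sym -subr_eq0; apply/negPn/negP => D0.
set D := _ - _ in D0.
have nD0 : 0 < `|D| by rewrite normr_gt0.
(* [|tau|^r |D| <= K |tau|^(p+1)] fails for small [tau <> 0] as soon as [D <> 0]. *)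
have : \forall tau \near (0 : C)^', False.
  near=> tau.
  have tau0 : tau != 0 by near: tau; exact: nbhs_dnbhs_neq.
  have tau1 : `|tau| < 1 by near: tau; exact: dnbhs0_lt.
  have tauK : `|tau| < `|D| / K by near: tau; apply: dnbhs0_lt; rewrite divr_gt0.
  have : `|chain_flow p (0 + tau) - rk_update M (chain_flow p 0) tau (chain_stage p tau)|
      <= K * `|tau ^+ p.+1|.
    near: tau; exact: nbhs_dnbhs KP.
  have rp' : (r < p.+1)%N by [].
  move=> /(le_trans (le_entry_norm _ (Ordinal rp') 0)).
  rewrite [X in `|X|]mxE [X in _ + X]mxE chain_updateE colfE add0r /=.
  rewrite -mulrBl -/D normrM !normrX => h.
  have {}h : `|D| <= K * `|tau| ^+ (p.+1 - r).
    have t0 : 0 < `|tau| ^+ r by rewrite exprn_gt0// normr_gt0.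
    by rewrite -(ler_pM2r t0) -mulrA -exprD subnK// ltnW.
  have : `|D| <= K * `|tau|.
    apply: le_trans h _; rewrite ler_pM2l// subSn// exprS ler_piMr//.
    by rewrite exprn_ile1// ltW.
  by rewrite -ler_pdivrMl// mulrC => /(lt_le_trans tauK); rewrite ltxx.
by move=> /filter_ex[].
Unshelve. all: by end_near.
Qed.

End OrderConditions.

(** * The one-step map of a linear problem *)

Section LinearStages.
Context {R : realType} {s d : nat}.
Local Notation C := (Cplx R).
Variables (M : rk_method R s) (A : 'M[C]_d.+1).
Local Notation f := (fun (_ : C) (x : 'cV[C]_d.+1) => A *m x).
Local Notation B := (rkA M)^T.
Implicit Types (k : 'I_s -> 'cV[C]_d.+1) (K : 'M[C]_(d.+1, s)) (tau : C).

(** Gathering the stages as the columns of one matrix turns the stage equations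
   into a linear matrix equation. *)
Definition stage_mx k : 'M[C]_(d.+1, s) := \matrix_(a, i) k i a 0.

Lemma l1norm_tr m n (X : 'M[C]_(m, n)) : l1norm X^T = l1norm X.
Proof.
rewrite /l1norm exchange_big; apply: eq_bigr => i _; apply: eq_bigr => j _.
by rewrite mxE.
Qed.

Lemma col_stage_mx k i : col i (stage_mx k) = k i.
Proof. by apply/colP => a; rewrite !mxE. Qed.

Lemma stage_mx_inj k k' : stage_mx k = stage_mx k' -> k = k'.
Proof. by move=> kk; apply/funext => i; rewrite -!col_stage_mx kk. Qed.

Lemma stage_sum k i : \sum_j rkA M i j *: k j = col i (stage_mx k *m B).
Proof.
apply/colP => a; rewrite summxE !mxE; apply: eq_bigr => j _.
by rewrite !mxE mulrC.
Qed.

Lemma rk_stagesE t x tau k : rk_stages M f t x tau k <->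
  stage_mx k = A *m x *m const_mx 1 + tau *: (A *m stage_mx k *m B).
Proof.
have rhs i : A *m (x + tau *: \sum_j rkA M i j *: k j) =
    col i (A *m x *m const_mx 1 + tau *: (A *m stage_mx k *m B)).
  rewrite stage_sum mulmxDr -scalemxAr !colE mulmxDl -scalemxAl -!mulmxA.
  congr (A *m _ + _); rewrite -colE; apply/colP => a.
  by rewrite !mxE big_ord1 !mxE mulr1.
split=> [h|h i]; last by rewrite rhs -h col_stage_mx.
by apply/matrixP => a i; have /colP/(_ a) := h i; rewrite rhs !mxE.
Qed.

Lemma stage_contraction tau K :
  l1norm (tau *: (A *m K *m B)) <= cabs tau * (l1norm A * l1norm (rkA M)) * l1norm K.
Proof.
rewrite l1normZ -mulrA ler_wpM2l ?cabs_ge0//.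
apply: le_trans (l1norm_mul _ _) _; rewrite l1norm_tr mulrAC ler_wpM2r ?l1norm_ge0//.
exact: l1norm_mul.
Qed.

Lemma stage_homogeneous tau K : cabs tau * (l1norm A * l1norm (rkA M)) < 1 ->
  K = tau *: (A *m K *m B) -> K = 0.
Proof.
move=> th KE; apply: l1norm_eq0; rewrite leNgt; apply/negP => K0.
have : l1norm K <= cabs tau * (l1norm A * l1norm (rkA M)) * l1norm K.
  by rewrite {1}KE; exact: stage_contraction.
by rewrite -{1}[l1norm K]mul1r ler_pM2r// leNgt th.
Qed.

(** The homogeneous stage equation only has the zero solution, so the linear map
   [K |-> K - tau A K B] on a finite-dimensional space is bijective. *)
Lemma rk_defined_linear t x tau : cabs tau * (l1norm A * l1norm (rkA M)) < 1 ->
  rk_defined M f t x tau.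
Proof.
move=> th.
pose L := 1%:M - tau *: (lin_mulmx A *m lin_mulmxr B) :
  'M[C]_(d.+1 * s).
have LE K : mxvec K *m L = mxvec (K - tau *: (A *m K *m B)).
  rewrite /L mulmxBr mulmx1 -scalemxAr mulmxA /lin_mulmx /lin_mulmxr !mul_vec_lin.
  by rewrite -linearZ -linearB.
have Lunit : L \in unitmx.
  rewrite -row_free_unit -kermx_eq0; apply/eqP/row_matrixP => i.
  rewrite row0; set v := row i _.
  have : v *m L = 0 by apply/sub_kermxP; exact: row_sub.
  rewrite -[v]vec_mxK LE => /eqP; rewrite mxvec_eq0 subr_eq0 => /eqP /stage_homogeneous.
  by move=> /(_ th) ->; rewrite linear0.
pose K0 := vec_mx (mxvec (A *m x *m const_mx 1 : 'M[C]_(d.+1, s)) *m invmx L).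
have K0E : K0 = A *m x *m const_mx 1 + tau *: (A *m K0 *m B).
  apply/eqP; rewrite -subr_eq; apply/eqP/(can_inj mxvecK).
  by rewrite -LE /K0 vec_mxK mulmxKV.
have sK0 : stage_mx (fun i => col i K0) = K0 by apply/matrixP => a i; rewrite !mxE.
exists (fun i => col i K0); split; first by apply/rk_stagesE; rewrite sK0.
move=> k /rk_stagesE kE; apply: stage_mx_inj; rewrite sK0; apply: subr0_eq.
apply: (stage_homogeneous th).
by rewrite {1}K0E {1}kE opprD addrACA subrr add0r -scalerBr -mulmxBl -mulmxBr.
Qed.

(** Substituting the stage equation [Q] times into itself: a Neumann series with
   exact remainder. *)
Lemma stage_expansion x tau K Q :
  K = A *m x *m const_mx 1 + tau *: (A *m K *m B) ->
  K = \sum_(q < Q) tau ^+ q *: (A ^+ q.+1 *m x *m (const_mx 1 : 'rV[C]_s) *m B ^+ q)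
      + tau ^+ Q *: (A ^+ Q *m K *m B ^+ Q).
Proof.
move=> KE; elim: Q => [|Q IH].
  by rewrite big_ord0 add0r !expr0 scale1r mul1mx mulmx1.
rewrite big_ord_recr /= -addrA {1}IH; congr (_ + _).
have inhomogeneous : A ^+ Q *m (A *m x *m (const_mx 1 : 'rV[C]_s)) *m B ^+ Q =
    A ^+ Q.+1 *m x *m const_mx 1 *m B ^+ Q.
  by rewrite exprSr !mulmxA.
rewrite {1}KE mulmxDr mulmxDl scalerDr inhomogeneous; apply: (congr1 (+%R _)).
by rewrite -scalemxAr -scalemxAl scalerA -exprSr 2!exprSr exprS !mulmxA.
Qed.

Lemma rk_updateE x tau k : rk_update M x tau k = x + tau *: (stage_mx k *m rkb M).
Proof.
rewrite /rk_update; congr (_ + _ *: _); apply/colP => a.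
by rewrite summxE mxE; apply: eq_bigr => i _; rewrite !mxE mulrC.
Qed.

Lemma weight_mx q :
  (const_mx 1 : 'rV[C]_s) *m B ^+ q *m rkb M = (rk_weight M q.+1)%:M.
Proof.
have BT : B ^+ q = (rkA M ^+ q)^T.
  elim: q => [|q IH]; first by rewrite !expr0 trmx1.
  by rewrite exprS IH exprSr; exact/esym/trmx_mul.
rewrite BT -trmx_const -trmx_mul -[rkA M ^+ q *m _]/(stage_weight M q).
apply/matrixP => i j; rewrite !ord1 !mxE eqxx mulr1n.
by apply: eq_bigr => l _; rewrite !mxE mulrC.
Qed.

Definition stability_sum (Q : nat) tau : 'M[C]_d.+1 :=
  \sum_(k < Q) (rk_weight M k * tau ^+ k) *: A ^+ k.

Lemma rk_update_expansion t x tau k Q : rk_stages M f t x tau k ->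
  rk_update M x tau k = stability_sum Q.+1 tau *m x
    + tau ^+ Q.+1 *: (A ^+ Q *m stage_mx k *m B ^+ Q *m rkb M).
Proof.
move=> /rk_stagesE kE; rewrite rk_updateE {1}(stage_expansion Q kE).
set K := stage_mx k.
rewrite mulmxDl scalerDr addrA -scalemxAl scalerA -exprS; congr (_ + _).
rewrite /stability_sum big_ord_recl [rk_weight M _]/(1 : C) mul1r.
rewrite expr0 scale1r expr0 mulmxDl mul1mx.
congr (_ + _); rewrite !mulmx_suml scaler_sumr; apply: eq_bigr => q _.
rewrite -!scalemxAl scalerA -exprS -!mulmxA (mulmxA (const_mx 1)) weight_mx.
by rewrite mul_mx_scalar -scalemxAr scalerA mulrC.
Qed.

Lemma stage_bound t x tau k : cabs tau * (l1norm A * l1norm (rkA M)) <= 2^-1 ->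
  rk_stages M f t x tau k ->
  l1norm (stage_mx k) <= 2 * (l1norm A * l1norm (const_mx 1 : 'rV[C]_s)) * l1norm x.
Proof.
move=> th /rk_stagesE kE; set K := stage_mx k in kE *.
have h1 : l1norm (A *m x *m (const_mx 1 : 'rV[C]_s)) <=
    l1norm A * l1norm x * l1norm (const_mx 1 : 'rV[C]_s).
  apply: le_trans (l1norm_mul _ _) _; rewrite ler_wpM2r ?l1norm_ge0//; exact: l1norm_mul.
have h2 : l1norm (tau *: (A *m K *m B)) <= 2^-1 * l1norm K.
  apply: (@le_trans _ _ (cabs tau * (l1norm A * l1norm (rkA M)) * l1norm K)); last first.
    by rewrite ler_wpM2r ?l1norm_ge0.
  exact: stage_contraction.
have : l1norm K <= l1norm A * l1norm x * l1norm (const_mx 1 : 'rV[C]_s) + 2^-1 * l1norm K.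
  by rewrite {1}kE; exact: le_trans (l1normD _ _) (lerD h1 h2).
by lra.
Qed.

Lemma rk_update_bound Q : exists2 K : R, 0 <= K & forall t x tau k,
  cabs tau * (l1norm A * l1norm (rkA M)) <= 2^-1 -> rk_stages M f t x tau k ->
  l1norm (rk_update M x tau k - stability_sum Q.+1 tau *m x) <=
  K * cabs tau ^+ Q.+1 * l1norm x.
Proof.
pose c := 2 * (l1norm A * l1norm (const_mx 1 : 'rV[C]_s)).
exists (l1norm (A ^+ Q) * c * l1norm (B ^+ Q) * l1norm (rkb M)).
  by rewrite !mulr_ge0 ?l1norm_ge0.
move=> t x tau k th kE; rewrite (rk_update_expansion Q kE) addrC addKr l1normZ cabsX.
rewrite -mulrA mulrCA ler_wpM2l ?exprn_ge0 ?cabs_ge0//.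
apply: le_trans (l1norm_mul _ _) _; rewrite [leRHS]mulrAC ler_wpM2r ?l1norm_ge0//.
apply: le_trans (l1norm_mul _ _) _; rewrite [leRHS]mulrAC ler_wpM2r ?l1norm_ge0//.
apply: le_trans (l1norm_mul _ _) _; rewrite -mulrA ler_wpM2l ?l1norm_ge0//.
exact: stage_bound th kE.
Qed.

End LinearStages.

(** * Local error and cancellation of the leading errors *)

Section LocalError.
Context {R : realType} {s d : nat}.
Local Notation C := (Cplx R).
Variables (M : rk_method R s) (A : 'M[C]_d.+1).
Local Notation f := (fun (_ : C) (x : 'cV[C]_d.+1) => A *m x).

Lemma stability_sum_order p (tau : C) : rk_order M p ->
  stability_sum M A p.+2 tau = exp_sum p.+2 (tau *: A)
    - (((p.+1)`!%:R^-1 - rk_weight M p.+1) * tau ^+ p.+1) *: A ^+ p.+1.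
Proof.
move=> hM.
have low : \sum_(k < p.+1) (rk_weight M k * tau ^+ k) *: A ^+ k = exp_sum p.+1 (tau *: A).
  rewrite /exp_sum; apply: eq_bigr => k _; rewrite exprZn scalerA.
  have kp : (k <= p)%N by rewrite -ltnS.
  by rewrite (rk_order_weight hM kp).
rewrite /stability_sum /exp_sum [LHS]big_ord_recr [X in _ = X - _]big_ord_recr low.
rewrite -[RHS]addrA; apply/eqP; rewrite (inj_eq (addrI _)); apply/eqP.
by rewrite exprZn scalerA -scalerBl mulrBl subKr.
Qed.

(** Both the exact and the numerical step have a Taylor expansion up to degree
   [p+1] in [tau A], and the two agree up to degree [p]; only the term of degree
   [p+1] survives at this precision, with the same coefficient [kappa] for all
   steps and all vectors. *)
Lemma rk_local_error p : rk_order M p ->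
  exists kappa : C, exists2 delta : R, 0 < delta & exists2 K : R, 0 <= K &
  forall t x tau, cabs tau <= delta ->
  rk_defined M f t x tau /\
  l1norm (rk_step M f t x tau
       - (expm (tau *: A) *m x - (kappa * tau ^+ p.+1) *: (A ^+ p.+1 *m x)))
  <= K * cabs tau ^+ p.+2 * l1norm x.
Proof.
move=> hM; exists ((p.+1)`!%:R^-1 - rk_weight M p.+1); set kappa := _ - _.
pose c := l1norm A * l1norm (rkA M).
have c0 : 0 <= c by rewrite mulr_ge0 ?l1norm_ge0.
have c1 : 0 < 1 + c by rewrite ltr_pwDl.
exists (2 * (1 + c))^-1; first by rewrite invr_gt0 mulr_gt0.
have [K1 K10 K1P] := rk_update_bound M A p.+1.
have [K2 K20 K2P] := @expm_taylor R d.
set a := l1norm A; have a0 : 0 <= a := l1norm_ge0 A.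
exists (K1 + K2 * (a ^+ p.+2 * expR a)).
  by rewrite addr_ge0// mulr_ge0// mulr_ge0 ?expR_ge0// exprn_ge0.
move=> t x tau taud.
have tau0 := cabs_ge0 tau.
have tau1 : cabs tau <= 1.
  by apply: le_trans taud _; rewrite invf_le1 ?mulr_gt0//; lra.
have th : cabs tau * c <= 2^-1.
  apply: (@le_trans _ _ ((2 * (1 + c))^-1 * (1 + c))).
    by apply: ler_pM => //; lra.
  by rewrite invfM -mulrA mulVf ?mulr1// gt_eqF.
have th1 : cabs tau * c < 1 by apply: le_lt_trans th _; lra.
have hd := rk_defined_linear t x th1.
split=> //.
have [k0 [k0P _]] := hd.
have kP : rk_stages M f t x tau (get [set k | rk_stages M f t x tau k]).
  exact: (@getPex _ [set k | rk_stages M f t x tau k] (ex_intro _ k0 k0P)).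
have := K1P _ _ _ _ th kP.
rewrite -/(rk_step M f t x tau) (stability_sum_order tau hM) -/kappa.
set y := rk_step _ _ _ _ _ => h1.
have h2 : l1norm (expm (tau *: A) - exp_sum p.+2 (tau *: A)) <=
    K2 * (a ^+ p.+2 * expR a) * cabs tau ^+ p.+2.
  apply: le_trans (K2P _ _) _; rewrite l1normZ -/a.
  apply: (@le_trans _ _ (K2 * ((cabs tau * a) ^+ p.+2 * expR a))).
    rewrite ler_wpM2l// ler_wpM2l ?exprn_ge0 ?mulr_ge0//.
    by rewrite ler_expR ler_piMl.
  rewrite exprMn (_ : K2 * _ = K2 * (a ^+ p.+2 * expR a) * cabs tau ^+ p.+2)//.
  by rewrite [cabs tau ^+ p.+2 * _]mulrC mulrAC; exact: mulrA.
have -> : y - (expm (tau *: A) *m x - (kappa * tau ^+ p.+1) *: (A ^+ p.+1 *m x)) =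
   (y - (exp_sum p.+2 (tau *: A) - (kappa * tau ^+ p.+1) *: A ^+ p.+1) *m x)
   - (expm (tau *: A) - exp_sum p.+2 (tau *: A)) *m x.
  by rewrite !mulmxBl -scalemxAl; apply/colP => i; rewrite !mxE; ring.
apply: le_trans (l1normB _ _) _.
rewrite [X in _ <= X * _]mulrDl [leRHS]mulrDl.
apply: lerD; first exact: h1.
by apply: le_trans (l1norm_mul _ _) _; rewrite ler_wpM2r ?l1norm_ge0.
Qed.

End LocalError.

Section Recurrence.
Context {R : realType} {m : nat}.
Local Notation C := (Cplx R).

(** Discrete Gronwall inequality. *)
Lemma l1norm_recurrence_growth (w : nat -> 'cV[C]_m) (g : R) n : 0 <= g ->
  (forall j, (j < n)%N -> l1norm (w j.+1) <= (1 + g) * l1norm (w j)) ->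
  forall j, (j <= n)%N -> l1norm (w j) <= expR (n%:R * g) * l1norm (w 0%N).
Proof.
move=> g0 hw j jn.
apply: (@le_trans _ _ (expR (j%:R * g) * l1norm (w 0%N))); last first.
  by rewrite ler_wpM2r ?l1norm_ge0// ler_expR ler_wpM2r// ler_nat.
elim: j jn => [|j IH] jn; first by rewrite mul0r expR0 mul1r.
apply: le_trans (hw _ jn) _.
rewrite -nat1r [(1 + j%:R) * g]mulrDl mul1r expRD -mulrA.
by apply: ler_pM; rewrite ?l1norm_ge0 ?addr_ge0 ?expR_ge1Dx// IH// ltnW.
Qed.

(** The factors [tau j ^+ p.+1] sum to zero, so the leading increments would cancel
   if [w j] were constant.  Since [w j - w0] is [O(h^p)] and there are at most
   [H / h] steps, the variation of [w] contributes [O(h^(2p))] and the remainders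
   [O(h^(p+1))]. *)
Lemma recurrence_cancellation p (D : 'M[C]_m) (G H : R) (w0 : 'cV[C]_m) :
  (0 < p)%N -> 0 <= G -> 0 <= H ->
  exists2 K : R, 0 <= K & forall (n : nat) (h : R) (w : nat -> 'cV[C]_m) (tau : nat -> C),
  0 <= h -> h <= 1 -> n%:R * h <= H -> w 0%N = w0 ->
  (forall j, (j < n)%N -> cabs (tau j) <= h) ->
  \sum_(j < n) tau j ^+ p.+1 = 0 ->
  (forall j, (j < n)%N ->
     l1norm (w j.+1 - (w j - tau j ^+ p.+1 *: (D *m w j))) <= G * h ^+ p.+2 * l1norm (w j)) ->
  l1norm (w n - w0) <= K * h ^+ p.+1.
Proof.
move=> p0 G0 H0; set D1 := l1norm D; have D0 : 0 <= D1 := l1norm_ge0 D.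
pose G2 := D1 + G; pose W := expR (H * G2) * l1norm w0.
have G20 : 0 <= G2 by rewrite addr_ge0.
have W0 : 0 <= W by rewrite mulr_ge0 ?expR_ge0 ?l1norm_ge0.
(* [W] bounds all [w j]; [H * G2 * W * h ^+ p] bounds [w j - w0]. *)
exists (H * (D1 * (H * G2 * W) + G * W)).
  by rewrite !(mulr_ge0, addr_ge0) ?expR_ge0 ?l1norm_ge0.
move=> n h w tau h0 h1 nh ww0 tauh tau0 hw.
pose rho j := w j.+1 - (w j - tau j ^+ p.+1 *: (D *m w j)).
have wS j : w j.+1 = w j - tau j ^+ p.+1 *: (D *m w j) + rho j by rewrite addrC subrK.
have hX q : 0 <= h ^+ q by rewrite exprn_ge0.
have tauX j : (j < n)%N -> cabs (tau j ^+ p.+1) <= h ^+ p.+1.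
  by move=> jn; rewrite cabsX lerXn2r ?nnegrE ?cabs_ge0// tauh.
have hle q : h ^+ q.+1 <= h ^+ q by rewrite exprS ler_piMl.
have inc j : (j < n)%N -> l1norm (w j.+1 - w j) <= G2 * h ^+ p.+1 * l1norm (w j).
  move=> jn; have -> : w j.+1 - w j = rho j - tau j ^+ p.+1 *: (D *m w j).
    by rewrite wS; apply/colP => i; rewrite !mxE; ring.
  apply: le_trans (l1normB _ _) _; rewrite addrC /G2 !mulrDl; apply: lerD.
    rewrite l1normZ [D1 * _]mulrC -mulrA; apply: ler_pM; rewrite ?cabs_ge0 ?l1norm_ge0 ?tauX//.
    exact: l1norm_mul.
  apply: le_trans (hw _ jn) _; rewrite ler_wpM2r ?l1norm_ge0//.
  by rewrite ler_wpM2l.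
have wW j : (j <= n)%N -> l1norm (w j) <= W.
  move=> jn.
  have grow i : (i < n)%N -> l1norm (w i.+1) <= (1 + G2 * h) * l1norm (w i).
    move=> ltin; rewrite -[w i.+1](subrK (w i)) addrC.
    apply: le_trans (l1normD _ _) _; rewrite mulrDl mul1r lerD2l.
    apply: le_trans (inc _ ltin) _; rewrite ler_wpM2r ?l1norm_ge0// ler_wpM2l//.
    by rewrite exprS ler_piMr// exprn_ile1.
  have := l1norm_recurrence_growth (mulr_ge0 G20 h0) grow jn; rewrite ww0.
  move=> /le_trans; apply; rewrite ler_wpM2r ?l1norm_ge0// ler_expR.
  by rewrite mulrCA mulrC ler_wpM2r.
have tel j : w j - w0 = \sum_(i < j) (w i.+1 - w i).
  by rewrite -(big_mkord xpredT (fun i => w i.+1 - w i)) telescope_sumr// ww0.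
have dev j : (j <= n)%N -> l1norm (w j - w0) <= H * G2 * W * h ^+ p.
  move=> jn; rewrite tel; apply: le_trans (l1norm_sum _ _ _) _.
  apply: (@le_trans _ _ (\sum_(i < j) G2 * h ^+ p.+1 * W)).
    apply: ler_sum => i _; have ltin := leq_trans (ltn_ord i) jn.
    apply: le_trans (inc _ ltin) _.
    by rewrite ler_wpM2l ?mulr_ge0 ?wW// ltnW.
  rewrite sumr_const card_ord -mulr_natl exprS.
  apply: (@le_trans _ _ (n%:R * h * (G2 * W * h ^+ p))).
    have -> : j%:R * (G2 * (h * h ^+ p) * W) = j%:R * h * (G2 * W * h ^+ p) by ring.
    apply: ler_wpM2r; first by apply: mulr_ge0 => //; exact: mulr_ge0.
    by rewrite ler_wpM2r// ler_nat.
  have -> : H * G2 * W * h ^+ p = H * (G2 * W * h ^+ p) by ring.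
  by apply: ler_wpM2r => //; apply: mulr_ge0 => //; exact: mulr_ge0.
have -> : w n - w0 =
    \sum_(j < n) (rho j - tau j ^+ p.+1 *: (D *m (w j - w0))).
  rewrite tel; have -> : \sum_(i < n) (w i.+1 - w i) =
    \sum_(i < n) (w i.+1 - w i) + (\sum_(i < n) tau i ^+ p.+1) *: (D *m w0).
    by rewrite tau0 scale0r addr0.
  rewrite scaler_suml -big_split /=; apply: eq_bigr => i _.
  have regroup (a r u v : 'cV[C]_m) : a - u + r - a + v = r - (u - v).
    by apply/colP => l; rewrite !mxE; ring.
  by rewrite (wS i) mulmxBr scalerBr; exact: regroup.
apply: le_trans (l1norm_sum _ _ _) _.
apply: (@le_trans _ _ (\sum_(i < n) (h * ((D1 * (H * G2 * W) + G * W) * h ^+ p.+1)))).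
  apply: ler_sum => i _; have ltin := ltn_ord i.
  apply: le_trans (l1normB _ _) _; rewrite addrC !mulrDl mulrDr; apply: lerD.
    rewrite l1normZ; apply: (@le_trans _ _ (h ^+ p.+1 * (D1 * (H * G2 * W * h ^+ p)))).
      apply: ler_pM; rewrite ?cabs_ge0 ?l1norm_ge0 ?tauX//.
      by apply: le_trans (l1norm_mul _ _) _; rewrite ler_wpM2l// dev// ltnW.
    have -> : h ^+ p.+1 * (D1 * (H * G2 * W * h ^+ p)) =
      h ^+ p.+1 * (D1 * (H * G2 * W)) * h ^+ p by ring.
    have -> : h * (D1 * (H * G2 * W) * h ^+ p.+1) =
      h ^+ p.+1 * (D1 * (H * G2 * W)) * h by ring.
    have c0 : 0 <= h ^+ p.+1 * (D1 * (H * G2 * W)).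
      by apply: mulr_ge0 => //; apply: mulr_ge0 => //; apply: mulr_ge0 => //; exact: mulr_ge0.
    apply: (ler_wpM2l c0).
    by rewrite -[leRHS]expr1 ler_wiXn2l.
  apply: le_trans (hw _ ltin) _.
  have -> : h * (G * W * h ^+ p.+1) = G * h ^+ p.+2 * W by rewrite [in RHS]exprS; ring.
  by apply: ler_wpM2l; [exact: mulr_ge0|apply: wW; exact: ltnW].
rewrite sumr_const card_ord -mulr_natl mulrA -[leRHS]mulrA; apply: ler_wpM2r => //.
apply: mulr_ge0 => //; apply: addr_ge0; last exact: mulr_ge0.
by apply: mulr_ge0 => //; apply: mulr_ge0 => //; exact: mulr_ge0.
Qed.

End Recurrence.

(** * Global error on a grid *)

(** One step seen after the pullback, with [S] the exact flow over the step, [F] its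
   inverse, [U] the pullback at the beginning of the step and [P] the power of
   [A] in the local error: the new pulled back vector is the old one, minus the
   leading increment, plus the image of the local remainder, minus a term that is
   small because [F] is close to the identity. *)
Lemma pullback_identity (K : comNzRingType) (n : nat) (F S U P : 'M[K]_n)
    (x y : 'cV[K]_n) (kappa c : K) :
  F *m S = 1%:M -> F *m U = U *m F -> P *m U = U *m P ->
  F *m U *m y - (U *m x - c *: (kappa *: P *m (U *m x))) =
  F *m U *m (y - (S *m x - (kappa * c) *: (P *m x)))
  - c *: ((F - 1%:M) *m (kappa *: P *m (U *m x))).
Proof.
move=> FS FU PU.
have e1 : F *m U *m (S *m x) = U *m x by rewrite FU -mulmxA (mulmxA F) FS mul1mx.
have e2 : F *m U *m (P *m x) = F *m (P *m (U *m x)).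
  by rewrite -mulmxA (mulmxA U) -PU -mulmxA.
rewrite !mulmxBr e1 -scalemxAr e2 mulmxBl mul1mx -!scalemxAl -!scalemxAr.
by apply/colP => i; rewrite !mxE; ring.
Qed.

Section GlobalError.
Context {R : realType} {s d : nat}.
Local Notation C := (Cplx R).
Variables (M : rk_method R s) (A : 'M[C]_d.+1).
Local Notation f := (fun (_ : C) (x : 'cV[C]_d.+1) => A *m x).
Local Notation E z := (expm (z *: A)).

Lemma expm_lineD (z w : C) : E (z + w) = E z *m E w.
Proof.
by rewrite scalerDl; apply: expmD; rewrite /GRing.comm -!scalerAl -!scalerAr !scalerA mulrC.
Qed.

Lemma expm_lineK (z : C) (x : 'cV[C]_d.+1) : E (- z) *m (E z *m x) = x.
Proof.
rewrite mulmxA -expm_lineD addNr scale0r expm0.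
exact: mul1mx.
Qed.

Lemma expm_line_comm (z : C) q : A ^+ q *m E z = E z *m A ^+ q.
Proof.
apply: expm_comm; rewrite /GRing.comm -scalerAr -scalerAl.
by congr (_ *: _); apply/esym/commrX.
Qed.

Lemma cabs_grid_le (T : nat -> C) (h : R) n :
  (forall j, (j < n)%N -> cabs (T j.+1 - T j) <= h) ->
  forall j, (j <= n)%N -> cabs (T j - T 0%N) <= j%:R * h.
Proof.
move=> hT; elim=> [|j IH] jn; first by rewrite subrr cabs0 mul0r.
rewrite -nat1r [(1 + _) * h]mulrDl mul1r -(subrK (T j) (T j.+1)) -addrA.
by apply: le_trans (cabsD _ _) _; apply: lerD; [exact: hT|apply: IH; exact: ltnW].
Qed.

(** Grids whose steps have [(p+1)]-th powers of sum zero gain one order.  Pulling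
   the numerical solution back to the initial time by the exact flow,
   [w j = e^(-(T j - T 0) A) x j], turns the leading local error into
   [kappa tau^(p+1) A^(p+1) w j] with a matrix that does not depend on [j], and
   [recurrence_cancellation] applies. *)
Theorem rk_grid_superconvergence p (H : R) (x0 : 'cV[C]_d.+1) :
  (0 < p)%N -> rk_order M p -> 0 <= H ->
  exists2 delta : R, 0 < delta & exists2 K : R, 0 <= K &
  forall (n : nat) (h : R) (T : nat -> C),
  0 <= h -> h <= delta -> n%:R * h <= H ->
  (forall j, (j < n)%N -> cabs (T j.+1 - T j) <= h) ->
  \sum_(j < n) (T j.+1 - T j) ^+ p.+1 = 0 ->
  (forall j, (j < n)%N ->
     rk_defined M f (T j) (rk_grid M f T x0 j) (T j.+1 - T j)) /\
  l1norm (E (T n - T 0%N) *m x0 - rk_grid M f T x0 n) <= K * h ^+ p.+1.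
Proof.
move=> p0 hM H0.
have [kappa [delta delta0 [Kl Kl0 KlP]]] := rk_local_error A hM.
have [L L0 LP] := @l1norm_expm R d.
have [K2 K20 K2P] := @expm_taylor R d.
set a := l1norm A; have a0 : 0 <= a := l1norm_ge0 A.
(* [B] bounds the flow over every time span met along the grid, and [N1 * h] its
   distance to the identity over one step. *)
pose B := L * expR (H * a).
have B0 : 0 <= B by rewrite mulr_ge0// expR_ge0.
pose D := kappa *: A ^+ p.+1.
pose N1 := K2 * (a * expR a).
have N10 : 0 <= N1 by rewrite mulr_ge0// mulr_ge0// expR_ge0.
pose G := B * (Kl * B) + N1 * l1norm D.
have G0 : 0 <= G.
  by apply: addr_ge0; apply: mulr_ge0 => //; [exact: mulr_ge0|exact: l1norm_ge0].
have [K K0 KP] := recurrence_cancellation D x0 p0 G0 H0.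
exists (Num.min delta 1); first by rewrite lt_min delta0 ltr01.
exists (B * K); first exact: mulr_ge0.
move=> n h T h0; rewrite le_min => /andP[hdelta h1] nh hT Tsum.
have tau_delta j : (j < n)%N -> cabs (T j.+1 - T j) <= delta.
  by move=> jn; exact: le_trans (hT _ jn) hdelta.
split; first by move=> j jn; have [] := KlP (T j) (rk_grid M f T x0 j) _ (tau_delta _ jn).
have EB z : cabs z <= H -> l1norm (E z) <= B.
  move=> zH; apply: le_trans (LP _) _; rewrite l1normZ.
  by apply: ler_wpM2l => //; rewrite ler_expR; apply: ler_wpM2r.
have TH j : (j <= n)%N -> cabs (T j - T 0%N) <= H.
  move=> jn; apply: le_trans (cabs_grid_le hT jn) _; apply: le_trans nh.
  by apply: ler_wpM2r => //; rewrite ler_nat.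
pose x j := rk_grid M f T x0 j.
pose w j := E (- (T j - T 0%N)) *m x j.
have xw j : x j = E (T j - T 0%N) *m w j.
  by rewrite /w -{1}[T j - T 0%N]opprK expm_lineK.
have w00 : w 0%N = x0.
  by rewrite /w /x /= subrr oppr0 scale0r expm0; exact: mul1mx.
have EN1 tau : cabs tau <= h -> l1norm (E (- tau) - 1) <= N1 * h.
  move=> tauh; have := K2P ((- tau) *: A) 1%N.
  rewrite {1}/exp_sum big_ord1 expr0 fact0 invr1 scale1r => /le_trans; apply.
  rewrite /N1 -mulrA; apply: ler_wpM2l => //; rewrite l1normZ cabsN -/a expr1.
  have -> : a * expR a * h = h * a * expR a by ring.
  apply: ler_pM; [by rewrite mulr_ge0 ?cabs_ge0|exact: expR_ge0|exact: ler_wpM2r|].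
  by rewrite ler_expR ler_piMl// (le_trans tauh).
have wrec j : (j < n)%N ->
    l1norm (w j.+1 - (w j - (T j.+1 - T j) ^+ p.+1 *: (D *m w j)))
    <= G * h ^+ p.+2 * l1norm (w j).
  move=> jn; set tau := T j.+1 - T j; set u := - (T j - T 0%N).
  have uE : - (T j.+1 - T 0%N) = - tau + u.
    by rewrite /tau /u -opprD addrA subrK.
  have [_] := KlP (T j) (x j) _ (tau_delta _ jn).
  rewrite -[rk_step _ _ _ _ _]/(x j.+1) -/tau.
  set r := _ - _ => hr.
  have -> : w j.+1 - (w j - tau ^+ p.+1 *: (D *m w j)) =
      E (- (T j.+1 - T 0%N)) *m r - tau ^+ p.+1 *: ((E (- tau) - 1) *m (D *m w j)).
    rewrite {1}/w uE expm_lineD; apply: pullback_identity.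
    - by rewrite -expm_lineD addNr scale0r expm0.
    - by rewrite -[LHS]expm_lineD -[RHS]expm_lineD [u + _]addrC.
    - exact: expm_line_comm.
  have hw : l1norm (x j) <= B * l1norm (w j).
    rewrite xw; apply: le_trans (l1norm_mul _ _) _.
    by apply: ler_wpM2r; [exact: l1norm_ge0|apply: EB; apply: TH; exact: ltnW].
  apply: le_trans (l1normB _ _) _.
  have -> : G * h ^+ p.+2 * l1norm (w j) = B * (Kl * h ^+ p.+2 * (B * l1norm (w j)))
      + h ^+ p.+1 * (N1 * h * (l1norm D * l1norm (w j))).
    by rewrite /G [h ^+ p.+2]exprS; ring.
  have tauh := hT _ jn.
  apply: lerD.
    apply: le_trans (l1norm_mul _ _) _.
    apply: ler_pM; rewrite ?l1norm_ge0//; first by apply: EB; rewrite cabsN; exact: TH.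
    apply: le_trans hr _; apply: ler_pM; rewrite ?l1norm_ge0//.
      by rewrite mulr_ge0 ?exprn_ge0 ?cabs_ge0.
    by apply: ler_wpM2l => //; rewrite lerXn2r// nnegrE cabs_ge0.
  rewrite l1normZ; apply: ler_pM; rewrite ?l1norm_ge0 ?cabs_ge0//.
    by rewrite cabsX lerXn2r// nnegrE cabs_ge0.
  apply: le_trans (l1norm_mul _ _) _; apply: ler_pM; rewrite ?l1norm_ge0//.
    exact: EN1.
  exact: l1norm_mul.
have := KP n h w (fun j => T j.+1 - T j) h0 h1 nh w00 hT Tsum wrec => hwn.
have -> : E (T n - T 0%N) *m x0 - rk_grid M f T x0 n = E (T n - T 0%N) *m (x0 - w n).
  by rewrite mulmxBr -xw.
apply: le_trans (l1norm_mul _ _) _; rewrite -mulrA; apply: ler_pM; rewrite ?l1norm_ge0//.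
  by apply: EB; exact: TH.
by rewrite l1norm_distC.
Qed.

End GlobalError.

(** * The grids of the circular arc *)

Section Cis.
Context {R : realType}.
Local Notation C := (Cplx R).

Definition cis (y : R) : C := cexp ('i * (y%:C%C : C)).

Lemma cisE y : cis y = Complex (cos y) (sin y).
Proof.
rewrite /cis -complexiE /cexp.
have -> : ('i%C * (y%:C%C : C)) = Complex 0 y :> C.
  by apply/eqP; rewrite eq_complex /= !(mul0r, mul1r, sub0r, oppr0, add0r, eqxx).
by rewrite /= expR0 !mul1r.
Qed.

Lemma cisD x y : cis (x + y) = cis x * cis y.
Proof.
by rewrite !cisE cosD sinD [sin x * _ + _]addrC.
Qed.

Lemma cis0 : cis 0 = 1.
Proof. by rewrite cisE cos0 sin0. Qed.

Lemma cisX y n : cis y ^+ n = cis (n%:R * y).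
Proof.
elim: n => [|n IH]; first by rewrite mul0r cis0.
by rewrite exprS IH -cisD -nat1r mulrDl mul1r.
Qed.

Lemma cabs_cis y : cabs (cis y) = 1.
Proof. by rewrite cisE /cabs /= cos2Dsin2 sqrtr1. Qed.

Lemma cis2pi : cis (- (pi *+ 2)) = 1.
Proof. by rewrite cisE cosN sinN cos2pi sin2pi oppr0. Qed.

Lemma trig_lipschitz0 (y : R) : 0 <= y -> `|cos y - 1| <= y /\ `|sin y| <= y.
Proof.
move=> y0.
have hc : {within `[0, y], continuous (@cos R)}.
  by apply: continuous_subspaceT => x; exact: continuous_cos.
have hs : {within `[0, y], continuous (@sin R)}.
  by apply: continuous_subspaceT => x; exact: continuous_sin.
split.
  have [x _] := @MVT_segment R cos (fun x => - sin x) _ _ y0 (fun x _ => is_derive_cos x) hc.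
  by rewrite cos0 subr0 => ->; rewrite normrM normrN (ger0_norm y0) ler_piMl// sin_max.
have [x _] := @MVT_segment R sin cos _ _ y0 (fun x _ => is_derive_sin x) hs.
by rewrite sin0 !subr0 => ->; rewrite normrM (ger0_norm y0) ler_piMl// cos_max.
Qed.

Lemma cabs_cis_sub1 (y : R) : 0 <= y -> cabs (cis (- y) - 1) <= 2 * y.
Proof.
move=> y0; have [h1 h2] := trig_lipschitz0 y0.
apply: le_trans (cabs_le_Re_Im _) _.
by rewrite cisE cosN sinN /= subr0 normrN mulr_natl mulr2n lerD.
Qed.

Lemma cis_root_neq1 n : (1 < n)%N -> cis (- (pi *+ 2 / n%:R)) != 1.
Proof.
move=> n1; rewrite cisE cosN; apply/eqP => -[+ _].
have n0 : 0 < n%:R :> R by rewrite ltr0n ltnW.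
have a0 : 0 < pi *+ 2 / n%:R :> R by rewrite divr_gt0// mulrn_wgt0// pi_gt0.
move=> c1; have /cos_inj h : cos (pi *+ 2 / n%:R) = cos 0 :> R by rewrite cos0.
have : pi *+ 2 / n%:R = 0 :> R.
  apply: h; rewrite in_itv /= ?lexx ?pi_ge0// (ltW a0) /=.
  by rewrite ler_pdivrMr// -[pi *+ 2]mulr_natr; apply: ler_wpM2l; rewrite ?pi_ge0// ler_nat.
by move=> a00; rewrite a00 ltxx in a0.
Qed.

Lemma sum_cis0 n : (1 < n)%N -> \sum_(j < n) cis (- (pi *+ 2 / n%:R)) ^+ j = 0.
Proof.
move=> n1; set w := cis _.
have w1 : w - 1 != 0 by rewrite subr_eq0 cis_root_neq1.
apply: (mulfI w1); rewrite -subrX1 mulr0 cisX.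
have n0 : n%:R != 0 :> R by rewrite pnatr_eq0 -lt0n ltnW.
by rewrite mulrN mulrC divfK// cis2pi subrr.
Qed.

End Cis.

Section GammaStar.
Context {R : realType}.
Local Notation C := (Cplx R).
Variables (p : nat) (t0 t : C).
Hypothesis hp : (0 < p)%N.

Local Notation s := (sin (pi / p.+1%:R : R)).
Definition radius : C := (t0 - t) / (2 * 'i * (s%:C%C : C)).

Lemma sin_gt0_frac : 0 < s.
Proof.
apply: sin_gt0_pi; rewrite divr_gt0 ?pi_gt0//=.
by rewrite ltr_pdivrMr// ltr_pMr ?pi_gt0// ltr1n.
Qed.

Lemma gamma_starE x : gamma_star p t0 t x =
  radius * (cis (pi * ((1 - 2 * x) / p.+1%:R)) - (cos (pi / p.+1%:R))%:C%C) + (t0 + t) / 2.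
Proof. by []. Qed.

Lemma radius_half : radius * ('i * (s%:C%C : C)) = (t0 - t) / 2.
Proof.
have s0 : (s%:C%C : C) != 0.
  by rewrite -[0]/((0 : R)%:C%C) (inj_eq (@complexI R)) gt_eqF// sin_gt0_frac.
have i0 : 'i != 0 :> C := neq0Ci _.
by rewrite /radius; field; rewrite s0 i0.
Qed.

Lemma cis_sub_cos (y : R) : cis y - (cos y)%:C%C = 'i * ((sin y)%:C%C : C).
Proof.
rewrite cisE -complexiE; apply/eqP.
by rewrite eq_complex /= !(subrr, oppr0, mul0r, mul1r, add0r, addr0, eqxx).
Qed.

Lemma gamma_star0 : gamma_star p t0 t 0 = t0.
Proof.
rewrite gamma_starE mulr0 subr0 mul1r cis_sub_cos radius_half.
by field.
Qed.

Lemma gamma_star1 : gamma_star p t0 t 1 = t.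
Proof.
rewrite gamma_starE.
have -> : pi * ((1 - 2 * 1) / p.+1%:R) = - (pi / p.+1%:R) :> R.
  by field; rewrite nat1r pnatr_eq0.
rewrite -cosN cis_sub_cos sinN rmorphN mulrN mulrN radius_half.
by field.
Qed.

Lemma gamma_star_step n j : (0 < n)%N ->
  time_grid (gamma_star p t0 t) n j.+1 - time_grid (gamma_star p t0 t) n j =
  radius * cis (pi / p.+1%:R) * (cis (- (pi *+ 2 / n%:R / p.+1%:R)) - 1)
  * cis (- (pi *+ 2 / n%:R / p.+1%:R)) ^+ j.
Proof.
move=> n0; have n0' : n%:R != 0 :> R by rewrite pnatr_eq0 -lt0n.
have p0 : p.+1%:R != 0 :> R by rewrite pnatr_eq0.
have angle i : cis (pi * ((1 - 2 * (i%:R / n%:R)) / p.+1%:R) : R) =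
    cis (pi / p.+1%:R) * cis (- (pi *+ 2 / n%:R / p.+1%:R)) ^+ i.
  rewrite cisX -cisD; congr cis; rewrite -mulr_natr; field.
  by rewrite [1 + p%:R]nat1r p0 n0'.
by rewrite /time_grid !gamma_starE !angle exprS; ring.
Qed.

(** A bound on the speed of the path; its quotient by [n] bounds the steps of the
   grid with [n] steps. *)
Definition gamma_star_speed : R := cabs radius * (2 * (pi *+ 2 / p.+1%:R)).

Lemma gamma_star_speed_ge0 : 0 <= gamma_star_speed.
Proof.
by rewrite /gamma_star_speed mulr_ge0 ?cabs_ge0// mulr_ge0// divr_ge0// mulrn_wge0// pi_ge0.
Qed.

Lemma gamma_star_step_le n j : (0 < n)%N ->
  cabs (time_grid (gamma_star p t0 t) n j.+1 - time_grid (gamma_star p t0 t) n j)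
  <= gamma_star_speed / n%:R.
Proof.
move=> n0; rewrite gamma_star_step//.
have step (a : C) x y z k : cabs (a * cis x * (cis y - 1) * cis z ^+ k) =
    cabs a * cabs (cis y - 1).
  by rewrite !cabsM cabsX !cabs_cis expr1n !mulr1.
rewrite step.
rewrite /gamma_star_speed -[leRHS]mulrA; apply: ler_wpM2l; first exact: cabs_ge0.
apply: le_trans (cabs_cis_sub1 _) _; last first.
  by rewrite -[leRHS]mulrA [pi *+ 2 / n%:R / _]mulrAC.
by rewrite !divr_ge0// mulrn_wge0// pi_ge0.
Qed.

(** The ratio of two successive steps is a primitive [n (p+1)]-th root of unity, so
   the [(p+1)]-th powers of the steps are proportional to the [n]-th roots of
   unity. *)
Lemma gamma_star_closed n : (1 < n)%N ->
  \sum_(j < n) (time_grid (gamma_star p t0 t) n j.+1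
                - time_grid (gamma_star p t0 t) n j) ^+ p.+1 = 0.
Proof.
move=> n1; have n0 := ltnW n1.
set c := radius * cis (pi / p.+1%:R) * (cis (- (pi *+ 2 / n%:R / p.+1%:R)) - 1).
have wX : cis (- (pi *+ 2 / n%:R / p.+1%:R)) ^+ p.+1 = cis (- (pi *+ 2 / n%:R)) :> C.
  by rewrite cisX mulrN [_ * (_ / p.+1%:R)]mulrC divfK ?pnatr_eq0.
rewrite (eq_bigr (fun j : 'I_n => c ^+ p.+1 * cis (- (pi *+ 2 / n%:R)) ^+ j)).
  by rewrite -mulr_sumr sum_cis0// mulr0.
by move=> j _; rewrite gamma_star_step// exprMn -exprM mulnC exprM wX.
Qed.

End GammaStar.

(** * Convergence of order p + 1 along the arc *)

Theorem corollary4p1 (R : realType) (d p s : nat) (hp : (0 < p)%N)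
    (A : 'M[Cplx R]_d.+1) (x0 : 'cV[Cplx R]_d.+1) (t0 t : Cplx R)
    (M : rk_method R s) (hM : rk_order M p) :
  let f : Cplx R -> 'cV[Cplx R]_d.+1 -> 'cV[Cplx R]_d.+1 :=
    fun _ x => A *m x in
  let gamma : R -> Cplx R := gamma_star p t0 t in
  let xD (n : nat) : nat -> 'cV[Cplx R]_d.+1 :=
    rk_grid M f (time_grid gamma n) x0 in
  [/\ gamma 0 = t0,
      gamma 1 = t,
      (\forall n \near \oo, forall j, (j < n)%N ->
         rk_defined M f (time_grid gamma n j) (xD n j)
           (time_grid gamma n j.+1 - time_grid gamma n j)) &
      (fun n : nat => expm ((t - t0) *: A) *m x0 - xD n n)
        =O_\oo (fun n : nat => 1 / (n%:R ^+ p.+1) : Cplx R)].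
Proof.
move=> f gamma xD.
have g0 : gamma 0 = t0 by exact: gamma_star0.
have g1 : gamma 1 = t by exact: gamma_star1.
set H := gamma_star_speed p t0 t; have H0 : 0 <= H := gamma_star_speed_ge0 p t0 t.
have [delta delta0 [K K0 KP]] := rk_grid_superconvergence A x0 hp hM H0.
have conv : \forall n \near \oo,
    (forall j, (j < n)%N ->
       rk_defined M f (time_grid gamma n j) (xD n j)
         (time_grid gamma n j.+1 - time_grid gamma n j)) /\
    l1norm (expm ((t - t0) *: A) *m x0 - xD n n) <= K * (H / n%:R) ^+ p.+1.
  have [N HN] : exists N : nat, H / delta < N%:R.
    by exists (Num.bound (H / delta)); apply: archi_boundP; rewrite divr_ge0// ltW.
  exists (maxn N 2) => // n /=; rewrite geq_max => /andP[Nn n2].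
  have n0 : (0 < n)%N := ltnW n2.
  have nR : 0 < n%:R :> R by rewrite ltr0n.
  have hd : H / n%:R <= delta.
    rewrite ler_pdivrMr// mulrC -ler_pdivrMr//.
    by apply/ltW/(lt_le_trans HN); rewrite ler_nat.
  have h0 : 0 <= H / n%:R by rewrite divr_ge0.
  have nh : n%:R * (H / n%:R) <= H by rewrite mulrC divfK// gt_eqF.
  have [] := KP n (H / n%:R) (time_grid gamma n) h0 hd nh _ (gamma_star_closed p t0 t n2).
    by move=> j _; exact: gamma_star_step_le.
  have -> : time_grid gamma n n = t by rewrite /time_grid divff ?gt_eqF.
  by have -> : time_grid gamma n 0 = t0 by rewrite /time_grid mul0r.
split=> //; first by apply: filterS conv => n [].
apply/eqO_exP; exists ((K * H ^+ p.+1 + 1)%:C%C : Cplx R).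
  by rewrite (ltcR 0) ltr_wpDl// mulr_ge0// exprn_ge0.
apply: filterS conv => n [_ h].
apply: le_trans (norm_le_l1norm _) _.
rewrite normC_cabs mul1r cabsV cabsX cabs_nat -rmorphM lecR.
apply: le_trans h _; rewrite expr_div_n mulrA ler_wpM2r ?invr_ge0 ?exprn_ge0//.
by rewrite lerDl.
Qed.
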